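(* Let $\mathcal{S}=\sum_{i\in I}^{\oplus}\mathcal{S}_i$, where each $\mathcal{S}_i$ is a countable subsemigroup of $\mathbb{R}_+=[0,\infty)$ containing $0$, and assume $\mathcal{S}$ is the positive cone of the group it generates. Let $(\mathcal{A},\mathcal{S},\alpha)$ be a semigroup dynamical system where $\mathcal{A}$ is a unital $C^*$-algebra. Let $(\sigma,T)$ be a contractive Nica-covariant representation of $(\mathcal{A},\mathcal{S},\alpha)$ on a Hilbert space $\mathcal{H}$. Then there is an isometric Nica-covariant representation $(\pi,V)$ of $(\mathcal{A},\mathcal{S},\alpha)$ on a Hilbert space $\mathcal{K}\supseteq\mathcal{H}$ such that (1) $\pi(A)|_{\mathcal{H}}=\sigma(A)$ for all $A\in\mathcal{A}$; (2) $P_{\mathcal{H}}V_s|_{\mathcal{H}}=T_s$ for all $s\in\mathcal{S}$. Further, $\mathcal{K}$ is minimal in the sense that $\mathcal{K}=\bigvee_{s\in\mathcal{S}}V_s\mathcal{H}$ (closed linear span).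
   Context: $\sum^{\oplus}_{i\in I}\mathcal{S}_i$ is the algebraic direct sum (finitely supported families), with each $\mathcal{S}_i$ regarded as a subsemigroup of $\mathcal{S}$. The group generated by $\mathcal{S}$ is $\mathcal{G}=\sum^{\oplus}_{i\in I}\mathcal{G}_i$ with $\mathcal{G}_i=\mathcal{S}_i-\mathcal{S}_i\subseteq\mathbb{R}$; that $\mathcal{S}$ is its positive cone means $\mathcal{S}_i=\mathcal{G}_i\cap[0,\infty)$ for each $i$. A contractive (isometric) representation of $\mathcal{S}$ on $\mathcal{H}$ is a family $\{T_s\}_{s\in\mathcal{S}}$ of contractions (isometries) in $\mathcal{B}(\mathcal{H})$ with $T_0=I$ and $T_{s+t}=T_sT_t$; it is Nica-covariant if $T_s^*T_t=T_tT_s^*$ whenever $s\in\mathcal{S}_i$, $t\in\mathcal{S}_j$, $i\neq j$. A semigroup dynamical system $(\mathcal{A},\mathcal{S},\alpha)$ consists of a unital operator algebra $\mathcal{A}$ and a family $\alpha=\{\alpha_s\}_{s\in\mathcal{S}}$ of completely isometric unital endomorphisms of $\mathcal{A}$ forming an action of $\mathcal{S}$ ($\alpha_0=\mathrm{id}$, $\alpha_{s+t}=\alpha_s\alpha_t$). An isometric (contractive) Nica-covariant representation of $(\mathcal{A},\mathcal{S},\alpha)$ on $\mathcal{H}$ is a pair $(\sigma,V)$ where $\sigma:\mathcal{A}\to\mathcal{B}(\mathcal{H})$ is a completely contractive representation and $V=\{V_s\}_{s\in\mathcal{S}}$ is an isometric (contractive) Nica-covariant representation of $\mathcal{S}$ on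 $\mathcal{H}$ with $\sigma(A)V_s=V_s\sigma(\alpha_s(A))$ for all $A\in\mathcal{A}$, $s\in\mathcal{S}$. $P_{\mathcal{H}}$ is the orthogonal projection of $\mathcal{K}$ onto $\mathcal{H}$. *)

(* Defs.v *)
From HB Require Import structures.
From mathcomp Require Import all_boot all_order all_algebra.
From mathcomp Require Import complex.
From mathcomp Require Import all_classical all_reals.
From mathcomp Require Import ereal topology normedtype.

Set Implicit Arguments.
Unset Strict Implicit.
Unset Printing Implicit Defensive.

Import Order.TTheory GRing.Theory Num.Theory.
Import numFieldNormedType.Exports.

Local Open Scope classical_set_scope.
Local Open Scope complex_scope.
Local Open Scope ring_scope.

(* The inner product is linear in the first argument and conjugate-linear in
   the second. *)
HB.mixin Record CompleteNormedModule_isHilbert (R : realType) H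
    & CompleteNormedModule R[i] H := {
  inner : {dot H for @Num.conj R[i]};
  inner_normE : forall x : H, `|x| ^+ 2 = inner x x
}.

#[short(type="hilbertType")]
HB.structure Definition Hilbert (R : realType) :=
  {H of CompleteNormedModule R[i] H & CompleteNormedModule_isHilbert R H}.

Notation "''[' x , y ]" := (inner x y) : ring_scope.

(* Unital C*-algebras. Multiplication and unit are fields because HB has no join
   of the ring and the normed module structures; this also keeps the zero
   algebra, which [algType] would exclude. *)
HB.mixin Record CompleteNormedModule_isCStarAlgebra (R : realType) A
    & CompleteNormedModule R[i] A := {
  cstar_one : A;
  cstar_mul : A -> A -> A;
  star : A -> A;
  cstar_mulA : associative cstar_mul;
  cstar_mul1r : left_id cstar_one cstar_mul;
  cstar_mulr1 : right_id cstar_one cstar_mul;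
  cstar_mulDl : left_distributive cstar_mul +%R;
  cstar_mulDr : right_distributive cstar_mul +%R;
  cstar_scalerAl : forall (c : R[i]) (a b : A),
    c *: cstar_mul a b = cstar_mul (c *: a) b;
  cstar_scalerAr : forall (c : R[i]) (a b : A),
    c *: cstar_mul a b = cstar_mul a (c *: b);
  starK : involutive star;
  starD : {morph star : a b / a + b};
  starZ : forall (c : R[i]) (a : A), star (c *: a) = c^* *: star a;
  starM : forall a b : A, star (cstar_mul a b) = cstar_mul (star b) (star a);
  cstar_normM : forall a b : A, `|cstar_mul a b| <= `|a| * `|b|;
  cstar_normE : forall a : A, `|cstar_mul (star a) a| = `|a| ^+ 2
}.

#[short(type="cstarType")]
HB.structure Definition CStarAlgebra (R : realType) :=
  {A of CompleteNormedModule R[i] A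
      & CompleteNormedModule_isCStarAlgebra R A}.

Notation "a ** b" := (cstar_mul a b) (at level 40, left associativity)
  : ring_scope.

Record bop (R : realType) (H K : hilbertType R) := BOp {
  bop_fun :> {linear H -> K};
  bop_continuous : continuous bop_fun
}.
Notation "''B' ( H )" := (bop H H) (at level 8, format "''B' ( H )").

HB.instance Definition _ (R : realType) (H K : hilbertType R) :=
  gen_eqMixin (bop H K).
HB.instance Definition _ (R : realType) (H K : hilbertType R) :=
  gen_choiceMixin (bop H K).

Section Operators.
Context (R : realType).
Implicit Types H K : hilbertType R.

Lemma bop0_continuous H K : continuous (\0 : {linear H -> K}).
Proof. by move=> x; exact: cvg_cst. Qed.

Definition bop0 H K : bop H K := BOp (@bop0_continuous H K).

(* By the Riesz representation theorem the set below is always a singleton, so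
   the default value is never used. *)
Definition adj H K (T : bop H K) : bop K H :=
  xget (bop0 K H) [set S | forall x y, '[T x, y] = '[x, S y]].

Definition contraction H K (T : bop H K) := forall x, `|T x| <= `|x|.
Definition isometric H K (T : bop H K) := forall x, `|T x| = `|x|.

(* Orthogonal projection onto E, a closed subspace. *)
Definition oproj H (E : set H) (x : H) : H :=
  xget 0 [set y | E y /\ forall z, E z -> '[x - y, z] = 0].

Definition lin_span H (E : set H) : set H :=
  [set x | exists n (c : 'I_n -> R[i]) (v : 'I_n -> H),
     (forall i, E (v i)) /\ x = \sum_(i < n) c i *: v i].

Definition l2norm H n (x : 'I_n -> H) : R :=
  Num.sqrt (\sum_(i < n) complex.Re `|x i| ^+ 2).

(* The norm of an operator matrix acting on the direct sum of n copies of H. *)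
Definition opmx_norm H n (M : 'M['B(H)]_n) : \bar R :=
  ereal_sup [set (l2norm (fun i => \sum_(j < n) M i j (x j)))%:E
            | x in [set x : 'I_n -> H | l2norm x <= 1]].

(* Representations are not required to preserve the unit. *)
Definition representation (A : cstarType R) H (rho : A -> 'B(H)) :=
  (forall (c : R[i]) a b x, rho (c *: a + b) x = c *: rho a x + rho b x) /\
  (forall a b, rho (a ** b) =1 rho a \o rho b).

Definition star_representation (A : cstarType R) H (rho : A -> 'B(H)) :=
  representation rho /\ forall a, rho (star a) =1 adj (rho a).

(* The C*-norm of M_n(A), that is the norm inherited from any faithful
   *-representation of A. *)
Definition cmx_norm (A : cstarType R) n (a : 'M[A]_n) : \bar R :=
  ereal_sup [set r | exists (H : hilbertType R) (rho : A -> 'B(H)),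
    star_representation rho /\ r = opmx_norm (map_mx rho a)].

Definition completely_contractive (A : cstarType R) H (rho : A -> 'B(H)) :=
  forall n (a : 'M[A]_n), (opmx_norm (map_mx rho a) <= cmx_norm a)%E.

Definition completely_isometric (A B : cstarType R) (f : A -> B) :=
  forall n (a : 'M[A]_n), cmx_norm (map_mx f a) = cmx_norm a.

Section DirectSum.
Context (I : Type) (S : I -> set R).

Definition dsum : set (I -> R) :=
  [set s | (forall i, S i (s i)) /\ finite_set [set i | s i != 0]].

(* S i regarded as a subsemigroup of the direct sum. *)
Definition summand (i : I) : set (I -> R) :=
  [set s | dsum s /\ forall j, j <> i -> s j = 0].

(* Families indexed by the direct sum are total functions on I -> R; their
   values outside [dsum] are irrelevant. *)

Definition semigroup_representation H (T : (I -> R) -> 'B(H)) :=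
  T 0 =1 id /\
  forall s t, dsum s -> dsum t -> T (s + t) =1 T s \o T t.

Definition nica_covariant H (T : (I -> R) -> 'B(H)) :=
  forall i j s t, i <> j -> summand i s -> summand j t ->
    adj (T s) \o T t =1 T t \o adj (T s).

Definition dynamical_system (A : cstarType R) (alpha : (I -> R) -> A -> A) :=
  [/\ forall s, dsum s ->
        [/\ linear (alpha s), {morph alpha s : a b / a ** b},
           alpha s cstar_one = cstar_one
          & completely_isometric (alpha s)],
      alpha 0 =1 id
    & forall s t, dsum s -> dsum t -> alpha (s + t) =1 alpha s \o alpha t].

Definition covariant (A : cstarType R) (alpha : (I -> R) -> A -> A) H
    (sigma : A -> 'B(H)) (V : (I -> R) -> 'B(H)) :=
  forall s a, dsum s -> sigma a \o V s =1 V s \o sigma (alpha s a).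

Definition nica_representation (A : cstarType R) (alpha : (I -> R) -> A -> A) H
    (sigma : A -> 'B(H)) (V : (I -> R) -> 'B(H)) :=
  [/\ representation sigma, completely_contractive sigma,
      semigroup_representation V, nica_covariant V & covariant alpha sigma V].

Definition contractive_nica_representation (A : cstarType R)
    (alpha : (I -> R) -> A -> A) H
    (sigma : A -> 'B(H)) (T : (I -> R) -> 'B(H)) :=
  nica_representation alpha sigma T /\ forall s, dsum s -> contraction (T s).

Definition isometric_nica_representation (A : cstarType R)
    (alpha : (I -> R) -> A -> A) H
    (sigma : A -> 'B(H)) (V : (I -> R) -> 'B(H)) :=
  nica_representation alpha sigma V /\ forall s, dsum s -> isometric (V s).

End DirectSum.
End Operators.

(* Main.v *)
Require Import Defs.
From HB Require Import structures.
From mathcomp Require Import all_boot all_order all_algebra.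
From mathcomp Require Import complex.
From mathcomp Require Import all_classical all_reals.
From mathcomp Require Import ereal topology normedtype sequences.
From mathcomp Require Import ring lra.

(** The dilation is the Kolmogorov space of a positive definite kernel. For
    [s] and [t] in the direct sum let [(s - t)^+] be the coordinatewise
    positive part; it belongs to the direct sum because of the cone
    condition. On formal sums of pairs [(s, h)], to be thought of as
    [V_s h], put
<<
      <(s, h), (t, g)> = <T_((s - t)^+) h, T_((t - s)^+) g>.
>>
    If this form is positive semidefinite, [K] is its completion, [H] is
    embedded as the pairs [(0, h)], and [V_u] is the shift
    [(s, h) |-> (s + u, h)], which preserves the form. Minimality and the
    compression formula [P_H V_s h = T_s h] are then read off the kernel.
    The adjoint of the shift is explicit,
    [V_u^* (s, h) = ((s - u)^+, T_((u - s)^+)^* h)], and visibly commutes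
    with the shift by [t] when [u] and [t] have disjoint supports
    ([shift_coshift]); so [V] is Nica-covariant.

    Positivity ([kernel_pos]) is shown one coordinate at a time. Suppose
    that the form which only sees the coordinates in [F] is positive, and
    let [i] be outside [F]. By Nica covariance the operators [T_r], [r] in
    [S i], commute with the kernel together with their adjoints, so that
    [T_r^* T_r] is symmetric for the form; as its powers are bounded, [T_r]
    is contractive for the form ([form_contraction]). A contractive
    semigroup indexed by a totally ordered cone has a positive definite
    kernel: sort the vectors by the coordinate [i] and add them in turn,
    latest first ([chain_bound]).

    The algebra acts by [pi(a) (s, h) = (s, sigma (alpha_s a) h)]. The
    covariance relation moves [sigma] through the kernel, and
    [pi(a)^* = pi(a^* )] on formal sums ([act_adj]) provided that each
    [sigma o alpha_s] preserves the involution. This holds because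
    contractive representations of a C*-algebra are *-representations
    ([contractive_rep_hermitian]). Conversely algebraic *-representations
    are contractive ([star_rep_contractive]), since [1 - a^* a] is a square
    [c^* c] for [|a| < 1]; hence [pi(a)] is bounded, and [pi], being a
    *-representation, is completely contractive. *)

Set Implicit Arguments.
Unset Strict Implicit.
Unset Printing Implicit Defensive.
Import Order.TTheory GRing.Theory Num.Theory.
Import numFieldNormedType.Exports.
Local Open Scope classical_set_scope.
Local Open Scope ring_scope.

(** * Complex scalars, real-valued norms, limits *)

Section Scalars.
Context {R : realType}.
Implicit Types z w : R[i].

Lemma Re_conj z : complex.Re z^* = complex.Re z. Proof. by case: z. Qed.
Lemma Im_conj z : complex.Im z^* = - complex.Im z. Proof. by case: z. Qed.
Lemma ReD z w : complex.Re (z + w) = complex.Re z + complex.Re w.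
Proof. by case: z; case: w. Qed.
Lemma ImD z w : complex.Im (z + w) = complex.Im z + complex.Im w.
Proof. by case: z; case: w. Qed.
Lemma ReN z : complex.Re (- z) = - complex.Re z. Proof. by case: z. Qed.
Lemma ImN z : complex.Im (- z) = - complex.Im z. Proof. by case: z. Qed.
Lemma ReM z w : complex.Re (z * w) =
  complex.Re z * complex.Re w - complex.Im z * complex.Im w.
Proof. by case: z; case: w. Qed.
Lemma ImM z w : complex.Im (z * w) =
  complex.Re z * complex.Im w + complex.Im z * complex.Re w.
Proof. by case: z; case: w. Qed.
Lemma Re0 : complex.Re (0 : R[i]) = 0. Proof. by []. Qed.
Lemma Im0 : complex.Im (0 : R[i]) = 0. Proof. by []. Qed.
Lemma Re1 : complex.Re (1 : R[i]) = 1. Proof. by []. Qed.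
Lemma Im1 : complex.Im (1 : R[i]) = 0. Proof. by []. Qed.
Lemma complex_ext z w : complex.Re z = complex.Re w ->
  complex.Im z = complex.Im w -> z = w.
Proof. by case: z w => a b [c d] /= -> ->. Qed.
Definition scalarE := (Re_conj, Im_conj, ReD, ImD, ReN, ImN, ReM, ImM,
  Re0, Im0, Re1, Im1).

Section Nm.
Context {V : normedZmodType R[i]}.
Implicit Types x y : V.

(** The norms of the theory take their values in the complex numbers, whose
    order is only partial; [nm] is the same norm with real values, so that
    inequalities can be handled by real arithmetic. *)
Definition nm x : R := complex.Re `|x|.

Lemma nmE x : `|x| = (nm x)%:C%C.
Proof.
have := normr_ge0 x; rewrite /nm; case: (`|x|) => a b.
by rewrite lecE /= => /andP[/eqP -> _].
Qed.

Lemma nm_ge0 x : 0 <= nm x.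
Proof. by have := normr_ge0 x; rewrite nmE lecR. Qed.

Lemma nmD x y : nm (x + y) <= nm x + nm y.
Proof. by have := ler_normD x y; rewrite !nmE -rmorphD/= lecR. Qed.

Lemma nmN x : nm (- x) = nm x. Proof. by rewrite /nm normrN. Qed.

Lemma nmB x y : nm (x - y) <= nm x + nm y.
Proof. by rewrite -(nmN y) nmD. Qed.

Lemma nmC x y : nm (x - y) = nm (y - x).
Proof. by rewrite -nmN opprB. Qed.

Lemma nm0 : nm (0 : V) = 0. Proof. by rewrite /nm normr0. Qed.

Lemma nm_le0 x : nm x <= 0 -> x = 0.
Proof.
move=> h; apply/eqP; rewrite -normr_eq0 nmE.
by have -> : nm x = 0 by apply/eqP; rewrite eq_le h nm_ge0.
Qed.
End Nm.

Lemma nmZ (V : normedModType R[i]) z (x : V) : nm (z *: x) = nm z * nm x.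
Proof. by rewrite {1}/nm normrZ !nmE ReM/= mul0r subr0. Qed.

Lemma nmM z w : nm (z * w) = nm z * nm w.
Proof. by rewrite {1}/nm normrM !nmE ReM/= mul0r subr0. Qed.

Lemma nm_conj z : nm z^* = nm z. Proof. by rewrite /nm norm_conjC. Qed.

Lemma nm_sq z : nm z ^+ 2 = complex.Re z ^+ 2 + complex.Im z ^+ 2.
Proof.
by rewrite /nm normc_def /= sqr_sqrtr// addr_ge0// sqr_ge0.
Qed.

Lemma nm_real (a : R) : nm a%:C%C = `|a|.
Proof. by rewrite /nm normc_def /= expr0n addr0 sqrtr_sqr. Qed.

Lemma Re_le_nm z : complex.Re z <= nm z.
Proof.
have := nm_sq z; have := nm_ge0 z; have := sqr_ge0 (complex.Im z).
by case: (leP (complex.Re z) 0) => *; nra.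
Qed.

Lemma normRe_le_nm z : `|complex.Re z| <= nm z.
Proof.
by rewrite ler_norml Re_le_nm andbT lerNl -ReN -(nmN z) Re_le_nm.
Qed.

Lemma normIm_le_nm z : `|complex.Im z| <= nm z.
Proof.
rewrite -ler_sqr ?nnegrE ?nm_ge0// real_normK ?num_real// nm_sq lerDr.
exact: sqr_ge0.
Qed.

Lemma nm_le_ReIm z : nm z <= `|complex.Re z| + `|complex.Im z|.
Proof.
rewrite -ler_sqr ?nnegrE ?nm_ge0 ?addr_ge0// nm_sq sqrrD.
rewrite !real_normK ?num_real// -addrA lerD2l lerDr mulrn_wge0//.
Qed.

(** Completeness in terms of error bounds: approximations [z j] with errors
    [r j] that do not contradict each other have a common limit. In this form a
    limit can be taken over all approximations at once, without choosing a
    sequence. *)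
Lemma nested_real (J : Type) (j0 : J) (z r : J -> R) :
  (forall j k, z j - r j <= z k + r k) ->
  exists c, forall j, `|c - z j| <= r j.
Proof.
move=> h; pose E := [set z j - r j | j in [set: J]].
have E0 : E !=set0 by exists (z j0 - r j0); exists j0.
have ub k : ubound E (z k + r k) by move=> _ [j _ <-].
have sE : has_sup E by split => //; exists (z j0 + r j0).
exists (sup E) => j; rewrite ler_norml lerBlDl ge_sup// andbT lerBrDr addrC.
by apply: ub_le_sup; [exact: sE.2|exists j].
Qed.

Lemma nested_complex (J : Type) (j0 : J) (z : J -> R[i]) (r : J -> R) :
  (forall j k, nm (z j - z k) <= r j + r k) ->
  exists c, forall j, nm (c - z j) <= 2 * r j.
Proof.
move=> h.
have [a ha] : exists a, forall j, `|a - complex.Re (z j)| <= r j.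
  apply: (nested_real j0 (z := fun j => complex.Re (z j))) => j k.
  have := le_trans (Re_le_nm _) (h j k).
  rewrite !scalarE; lra.
have [b hb] : exists b, forall j, `|b - complex.Im (z j)| <= r j.
  apply: (nested_real j0 (z := fun j => complex.Im (z j))) => j k.
  have := le_trans (le_trans (ler_norm _) (normIm_le_nm _)) (h j k).
  rewrite !scalarE; lra.
exists (a +i* b)%C => j; apply: le_trans (nm_le_ReIm _) _.
by rewrite mulr_natl mulr2n !scalarE lerD.
Qed.

(** In a complete space the errors have to become arbitrarily small; then the
    sets of good approximations generate a Cauchy filter. *)
Lemma nested_complete (V : completeNormedModType R[i]) (J : Type)
    (z : J -> V) (r : J -> R) :
  (forall e, 0 < e -> exists j, r j <= e) ->
  (forall j k, nm (z j - z k) <= r j + r k) ->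
  exists c, forall j, nm (c - z j) <= r j.
Proof.
move=> rlim h.
pose B (e : R) := [set z j | j in [set j | r j <= e]].
pose F := filter_from [set e : R | 0 < e] B.
have FF : ProperFilter F.
  apply: filter_from_proper => [|e /rlim[j rj]]; last by exists (z j); exists j.
  apply: filter_from_filter; first by exists 1 => /=.
  move=> a b /= a0 b0; exists (Num.min a b); first by rewrite /= lt_min a0.
  by move=> _ [j /= + <-]; rewrite le_min => /andP[ra rb]; split; exists j.
have /cauchy_cvgP/cvg_ex[c Fc] : cauchy F.
  apply/cauchy_ballP => e e0; have eE : e = (complex.Re e)%:C%C.
    by rewrite RRe_real// gtr0_real.
  have {}e0 : 0 < complex.Re e by move: e0; rewrite eE ltcR.
  have he : 0 < complex.Re e / 3 by rewrite divr_gt0.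
  exists (B (complex.Re e / 3), B (complex.Re e / 3)).
    by split; exists (complex.Re e / 3).
  move=> [_ _] [[j /= rj <-] [k /= rk <-]]; rewrite -ball_normE /=.
  rewrite nmE eE ltcR; apply: le_lt_trans (h _ _) _; lra.
exists c => j; apply/ler_addgt0Pl => e e0.
have he : 0 < e / 2 by rewrite divr_gt0.
have /fcvgrPdist_lt/(_ (e / 2)%:C%C) := Fc.
rewrite ltcR => /(_ he)[d /= d0].
have hm : 0 < Num.min d (e / 2) by rewrite lt_min d0 he.
have [k] := rlim _ hm; rewrite le_min => /andP[rd re] /(_ (z k)).
have Bk : B d (z k) by exists k.
move=> /(_ Bk); rewrite nmE ltcR => /ltW hk.
have -> : c - z j = (c - z k) + (z k - z j) by rewrite addrA subrK.
apply: le_trans (nmD _ _) _; have := h k j; lra.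
Qed.

End Scalars.

(** * Semi-inner products *)

Section SemiInner.
Context {R : realType} {V : Type}.
Variables (add : V -> V -> V) (scale : R[i] -> V -> V).

(** A positive semidefinite hermitian form. The axioms of a vector space are not
    imposed on [V], so that formal sums, represented by sequences, qualify. *)
Record semi_inner (B : V -> V -> R[i]) : Prop := SemiInner {
  form_inhabited : inhabited V;
  formDl : forall u v w, B (add u v) w = B u w + B v w;
  formZl : forall c u v, B (scale c u) v = c * B u v;
  formC : forall u v, B u v = (B v u)^*;
  form_ge0 : forall u, 0 <= complex.Re (B u u)
}.

Definition seminorm (B : V -> V -> R[i]) (u : V) : R :=
  Num.sqrt (complex.Re (B u u)).

Variable B : V -> V -> R[i].
Hypothesis hB : semi_inner B.

Definition vsub u v := add u (scale (- 1) v).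

Lemma formDr u v w : B u (add v w) = B u v + B u w.
Proof. by rewrite formC// formDl// rmorphD/= -!(formC hB). Qed.

Lemma formZr c u v : B u (scale c v) = c^* * B u v.
Proof. by rewrite formC// formZl// rmorphM/= -(formC hB). Qed.

Lemma formBl u v w : B (vsub u v) w = B u w - B v w.
Proof. by rewrite /vsub formDl// formZl// mulN1r. Qed.

Lemma formBr u v w : B u (vsub v w) = B u v - B u w.
Proof. by rewrite /vsub formDr formZr rmorphN rmorph1 mulN1r. Qed.

Lemma form_Im u : complex.Im (B u u) = 0.
Proof. by apply/eqP; rewrite -eqNr -Im_conj -(formC hB). Qed.

Lemma seminorm_ge0 u : 0 <= seminorm B u. Proof. exact: sqrtr_ge0. Qed.

Lemma seminorm_sq u : seminorm B u ^+ 2 = complex.Re (B u u).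
Proof. by rewrite sqr_sqrtr// form_ge0. Qed.

Lemma formE u : B u u = (seminorm B u ^+ 2)%:C%C.
Proof. by apply: complex_ext; rewrite /= ?form_Im// seminorm_sq. Qed.

Lemma seminormZ c u : seminorm B (scale c u) = nm c * seminorm B u.
Proof.
rewrite /seminorm formZl// formZr mulrA ReM form_Im mulr0 subr0.
have -> : complex.Re (c * c^*) = nm c ^+ 2 by rewrite nm_sq !scalarE; ring.
by rewrite sqrtrM ?sqr_ge0// sqrtr_sqr ger0_norm// nm_ge0.
Qed.

(** The choice [t = 1 / b] minimises the quadratic polynomial. *)
Lemma discriminant (a b n : R) : 0 <= a -> 0 <= b -> 0 <= n ->
  (forall t, 0 <= a - 2 * t * n + t ^+ 2 * n * b) -> n <= a * b.
Proof.
move=> a0 b0 n0 h; have [b_gt0|] := ltP 0 b; last first.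
  move=> b_le0; have b_eq0 : b = 0 by apply/eqP; rewrite eq_le b0 b_le0.
  rewrite b_eq0 mulr0 leNgt; apply/negP => n_gt0.
  have := h ((a + 1) / (2 * n)); rewrite b_eq0 mulr0 addr0.
  have -> : 2 * ((a + 1) / (2 * n)) * n = a + 1 by field; lra.
  lra.
have := h b^-1.
have -> : a - 2 * b^-1 * n + b^-1 ^+ 2 * n * b = (a * b - n) / b.
  by field; lra.
by rewrite ler_pdivlMr// mul0r subr_ge0.
Qed.

Lemma cauchy_schwarz u v : nm (B u v) <= seminorm B u * seminorm B v.
Proof.
rewrite -ler_sqr ?nnegrE ?mulr_ge0 ?seminorm_ge0 ?nm_ge0//.
rewrite exprMn !seminorm_sq; apply: discriminant; rewrite ?form_ge0 ?sqr_ge0//.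
move=> t; have := form_ge0 hB (add u (scale ((- t)%:C%C * B u v) v)).
rewrite formDl// !formDr !formZl// !formZr (formC hB v u) nm_sq !scalarE.
rewrite !form_Im /= => ge0; rewrite (le_trans ge0)// le_eqVlt.
by apply/orP; left; apply/eqP; ring.
Qed.

Lemma seminormD u v : seminorm B (add u v) <= seminorm B u + seminorm B v.
Proof.
rewrite -ler_sqr ?nnegrE ?addr_ge0 ?seminorm_ge0//.
rewrite seminorm_sq formDl// !formDr (formC hB v u) !scalarE -!seminorm_sq.
have := le_trans (Re_le_nm _) (cauchy_schwarz u v); nra.
Qed.

Lemma seminorm_le u c : 0 <= c -> (forall v, nm (B u v) <= c * seminorm B v) ->
  seminorm B u <= c.
Proof.
move=> c0 /(_ u); rewrite formE nm_real ger0_norm ?sqr_ge0//.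
have := seminorm_ge0 u; rewrite le_eqVlt => /orP[/eqP <-//|u0].
by rewrite expr2 ler_pM2r.
Qed.

(** Iterating the Cauchy-Schwarz inequality gives
    [<C u, u> ^ (2 ^ n) <= <u, u> ^ (2 ^ n - 1) * <C ^ (2 ^ n) u, u>]. If
    [<C u, u>] exceeded [<u, u>], the last factor would be unbounded. This
    avoids the square roots of positive operators. *)
Lemma symmetric_power_bounded (C : V -> V) u M :
  (forall v w, B (C v) w = B v (C w)) ->
  (forall n, complex.Re (B (iter n C u) u) <= M) ->
  complex.Re (B (C u) u) <= complex.Re (B u u).
Proof.
move=> symC bound.
have symn n v w : B (iter n C v) w = B v (iter n C w).
  by elim: n v w => // n IH v w; rewrite /= symC IH -iterSr.
set c := complex.Re (B u u); have c0 : 0 <= c by exact: form_ge0.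
(* As [x n ^ 2 <= c * x n.+1], the sequence is unbounded if [x 0 > c]. *)
pose x n := complex.Re (B (iter (2 ^ n) C u) u).
have x_sq n : x n ^+ 2 <= c * x n.+1.
  rewrite -[c]seminorm_sq.
  have -> : x n.+1 = seminorm B (iter (2 ^ n) C u) ^+ 2.
    by rewrite seminorm_sq /x expnS mul2n -addnn iterD symn.
  rewrite -exprMn -real_normK ?num_real//.
  rewrite ler_sqr ?nnegrE ?mulr_ge0 ?seminorm_ge0//.
  by rewrite mulrC; apply: le_trans (normRe_le_nm _) (cauchy_schwarz _ _).
rewrite -[complex.Re (B (C u) u)]/(x 0%N) leNgt; apply/negP => c_lt.
have c_gt0 : 0 < c.
  rewrite lt_neqAle c0 andbT; apply/negP => /eqP c_eq.
  have := x_sq 0%N; rewrite -c_eq mul0r leNgt exprn_gt0//.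
  by rewrite c_eq.
pose d := x 0%N / c - 1.
have d0 : 0 < d by rewrite subr_gt0 ltr_pdivlMr// mul1r.
have grow n : c * (1 + n%:R * d + d) <= x n.
  elim: n => [|n IH].
    by rewrite mul0r addr0 /d addrC subrK mulrC divfK// gt_eqF.
  have n0 : 0 <= n%:R :> R by [].
  rewrite -(ler_pM2l c_gt0); apply: le_trans (x_sq n).
  set e := n%:R * d + d; rewrite -addrA -/e in IH.
  have e0 : 0 <= e by rewrite addr_ge0 ?mulr_ge0 ?(ltW d0).
  have ce0 : 0 <= c * (1 + e) by rewrite mulr_ge0// addr_ge0.
  have de : d <= e by rewrite lerDr mulr_ge0// ltW.
  apply: (@le_trans _ _ ((c * (1 + e)) ^+ 2)); last first.
    by rewrite ler_sqr ?nnegrE// (le_trans ce0).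
  have -> : 1 + n.+1%:R * d + d = 1 + e + d by rewrite -natr1 /e; ring.
  have : 0 <= c ^+ 2 * (e - d + e ^+ 2).
    by rewrite mulr_ge0 ?sqr_ge0// addr_ge0 ?sqr_ge0// subr_ge0.
  lra.
have cd_gt0 : 0 < c * d by rewrite mulr_gt0.
have := archi_boundP (normr_ge0 (M / (c * d))).
set n := Num.bound _ => /(le_lt_trans (ler_norm _)).
rewrite ltr_pdivrMr//; have := le_trans (grow n) (bound _); nra.
Qed.
End SemiInner.

(** * Hilbert spaces: the Riesz theorem and adjoints *)

Section HilbertSpace.
Context {R : realType}.
Implicit Types H K : hilbertType R.

Lemma inner_semi H : semi_inner +%R *:%R (@inner R H).
Proof.
split => [|u v w|c u v|u v|u].
- exact: inhabits 0.
- exact: linearDl.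
- exact: linearZl_LR.
- by rewrite hermC expr0 mul1r.
- by have := dnorm_ge0 (@inner R H) u; rewrite lecE => /andP[].
Qed.

Definition innerDl H := formDl (@inner_semi H).
Definition innerZl H := formZl (@inner_semi H).
Definition innerC H := formC (@inner_semi H).
Definition innerDr H := formDr (@inner_semi H).
Definition innerZr H := formZr (@inner_semi H).

Lemma innerBl H (x y z : H) : '[x - y, z] = '[x, z] - '[y, z].
Proof. by rewrite -scaleN1r innerDl innerZl mulN1r. Qed.

Lemma innerBr H (x y z : H) : '[x, y - z] = '[x, y] - '[x, z].
Proof. by rewrite innerC innerBl rmorphB/= -!innerC. Qed.

Lemma inner_nm H (x : H) : '[x, x] = (nm x ^+ 2)%:C%C.
Proof. by rewrite -inner_normE nmE -rmorphXn. Qed.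

Lemma seminorm_inner H (x : H) : seminorm (@inner R H) x = nm x.
Proof. by rewrite /seminorm inner_nm /= sqrtr_sqr ger0_norm ?nm_ge0. Qed.

Lemma nm_sqE H (x : H) : nm x ^+ 2 = complex.Re '[x, x].
Proof. by rewrite inner_nm. Qed.

Lemma inner_le H (x y : H) : nm '[x, y] <= nm x * nm y.
Proof.
by rewrite -!seminorm_inner; exact: cauchy_schwarz (inner_semi H) x y.
Qed.

Lemma inner_eq0 H (x : H) : (forall y, '[x, y] = 0) -> x = 0.
Proof.
move=> /(_ x); rewrite inner_nm => /(congr1 (@complex.Re R))/= /eqP.
by rewrite sqrf_eq0 => /eqP x0; apply: nm_le0; rewrite x0.
Qed.

Lemma inner_inj H (x y : H) : (forall z, '[x, z] = '[y, z]) -> x = y.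
Proof.
by move=> h; apply/subr0_eq/inner_eq0 => z; rewrite innerBl h subrr.
Qed.

Lemma inner_injr H (x y : H) : (forall z, '[z, x] = '[z, y]) -> x = y.
Proof. by move=> h; apply: inner_inj => z; rewrite innerC h -innerC. Qed.

Lemma bop_bounded H K (T : bop H K) :
  exists2 M, 0 <= M & forall x, nm (T x) <= M * nm x.
Proof.
have /linear_boundedP/pinfty_ex_gt0[M M0 hM] :=
  continuous_linear_bounded 0 (@bop_continuous _ _ _ T 0).
move: M0 hM; rewrite ltcE => /andP[/eqP/= M_real M0] hM.
exists (complex.Re M) => [|x]; first exact: ltW.
have := hM x; rewrite !nmE.
have -> : M = (complex.Re M)%:C%C by apply: complex_ext.
by rewrite -rmorphM lecR.
Qed.

Lemma bop_exists H K (f : H -> K) : linear f ->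
  (exists M, forall x, nm (f x) <= M * nm x) -> exists T : bop H K, T =1 f.
Proof.
move=> lin_f [M hM].
pose F : {linear H -> K} := HB.pack f (GRing.isLinear.Build _ _ _ _ f lin_f).
suff cF : continuous F by exists (BOp cF).
apply/bounded_linear_continuous/linear_boundedP.
exists M%:C%C; split; first by rewrite complex_real.
move=> r; rewrite ltcE => /andP[/eqP/= r_real Mr] x.
have -> : r = (complex.Re r)%:C%C by apply: complex_ext.
rewrite !nmE -rmorphM lecR; apply: le_trans (hM x) _.
by rewrite ler_wpM2r ?nm_ge0// ltW.
Qed.

Lemma le_of_eps (a b c : R) : 0 <= c -> (forall e, 0 < e -> a <= b + e * c) ->
  a <= b.
Proof.
move=> c0 h; apply/ler_addgt0Pr => e e0.
have d0 : 0 < c + 1 by rewrite ltr_wpDl.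
apply: le_trans (h (e / (c + 1)) _) _; first by rewrite divr_gt0.
rewrite lerD2l mulrAC ler_pdivrMr// ler_pM2l//; lra.
Qed.

(** The Riesz theorem: a functional [f] is represented by the minimiser of
    [|y|^2 - 2 Re f y]. Approximate minimisers are close to each other by the
    parallelogram identity. *)
Lemma riesz H (f : H -> R[i]) :
  (forall x y, f (x + y) = f x + f y) -> (forall c x, f (c *: x) = c * f x) ->
  (exists M, forall x, nm (f x) <= M * nm x) ->
  exists c, forall x, f x = '[x, c].
Proof.
move=> fD fZ [M hM].
pose q (y : H) := nm y ^+ 2 - 2 * complex.Re (f y).
have q_lb y : - M ^+ 2 <= q y.
  have := le_trans (Re_le_nm _) (hM y); have := sqr_ge0 (nm y - M); rewrite /q.
  nra.
pose E := [set q y | y in [set: H]].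
have hE : has_inf E.
  by split; [exists (q 0); exists 0|exists (- M ^+ 2) => _ [y _ <-]].
pose m := inf E.
have m_le y : m <= q y by apply: ge_inf; [exact: hE.2|exists y].
(* Pairs of an approximate minimiser and its precision. *)
pose J := {p : H * R | 0 < p.2 /\ q p.1 <= m + p.2 ^+ 2}.
have near_min e : 0 < e -> exists j : J, (sval j).2 = e.
  move=> e0; have [_ [y _ <-]] := inf_adherent (exprn_gt0 2 e0) hE.
  by move=> /ltW hy; exists (exist _ (y, e) (conj e0 hy)).
have [c hc] : exists c, forall j : J, nm (c - (sval j).1) <= 2 * (sval j).2.
  apply: nested_complete => [e e0|[[y d] /= [d0 hy]] [[y' d'] /= [d'0 hy']]].
    have e2 : 0 < e / 2 by rewrite divr_gt0.
    by have [j je] := near_min _ e2; exists j; rewrite je; lra.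
  rewrite -ler_sqr ?nnegrE ?nm_ge0//; last lra.
  have := m_le (2^-1 *: (y + y')); move: hy hy'.
  rewrite /q fZ fD !nm_sqE innerBl !innerBr innerZl innerZr !innerDl !innerDr.
  have -> : (2^-1 : R[i])^* = 2^-1 by rewrite conj_Creal// rpredV ?realn.
  have -> : (2^-1 : R[i]) = (2^-1)%:C%C by rewrite rmorphV ?unitfE// rmorph_nat.
  rewrite !scalarE /=; set xx := complex.Re _; nra.
exists c.
(* At an approximate minimiser [y] the variation of [q] in the direction [z]
   is almost zero, so that [Re <z, y>] is close to [Re f z]. *)
have ReE z : complex.Re (f z) = complex.Re '[z, c].
  apply/eqP; rewrite -subr_eq0 -normr_le0.
  apply: (@le_of_eps _ _ (3 * nm z)); first by rewrite mulr_ge0 ?nm_ge0.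
  move=> e e0; rewrite add0r; have [j je] := near_min e e0.
  have := hc j; have := (svalP j).2; rewrite je; set y := (sval j).1 => hy hcy.
  have step1 : `|complex.Re (f z) - complex.Re '[z, y]| <= e * nm z.
    rewrite -ler_sqr ?nnegrE ?mulr_ge0 ?nm_ge0 ?(ltW e0)//.
    rewrite real_normK ?num_real// exprMn.
    apply: discriminant; rewrite ?sqr_ge0// => t.
    set p := complex.Re (f z) - _.
    have := le_trans (m_le (y + (t * p)%:C%C *: z)) (lexx _).
    rewrite /q fD fZ nm_sqE innerDl !innerDr !innerZr !innerZl (innerC y z).
    rewrite !scalarE !inner_nm /=; move: hy; rewrite /q /p; lra.
  have step2 : `|complex.Re '[z, y] - complex.Re '[z, c]| <= 2 * e * nm z.
    rewrite -ReN -ReD -innerBr; apply: le_trans (normRe_le_nm _) _.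
    apply: le_trans (inner_le _ _) _; rewrite nmC mulrC.
    by rewrite ler_wpM2r ?nm_ge0.
  rewrite -[X in X - _](subrK (complex.Re '[z, y])) -addrA.
  apply: le_trans (ler_normD _ _) _; lra.
move=> x; apply: complex_ext; first exact: ReE.
have := ReE ('i%C *: x); rewrite fZ innerZl !ReM /= !mul0r !mul1r; lra.
Qed.

End HilbertSpace.

Section Adjoint.
Context {R : realType}.
Implicit Types H K : hilbertType R.

(** The representing vector of [x |-> <T x, y>] depends linearly and boundedly
    on [y]. Hence the default value in the definition of [adj] never occurs. *)
Lemma adj_exists H K (T : bop H K) :
  exists S : bop K H, forall x y, '[T x, y] = '[x, S y].
Proof.
have [M M0 hM] := bop_bounded T.
have ex y : exists c, forall x, '[T x, y] = '[x, c].
  apply: riesz => [u v|c u|]; first by rewrite linearD innerDl.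
    by rewrite linearZ innerZl.
  exists (M * nm y) => x; apply: le_trans (inner_le _ _) _.
  by rewrite mulrAC ler_wpM2r ?nm_ge0.
pose s y := sval (cid (ex y)).
have sE x y : '[T x, y] = '[x, s y] by rewrite /s; case: cid.
have s_lin : linear s.
  move=> c y z; apply: inner_injr => x.
  by rewrite innerDr innerZr -!sE innerDr innerZr.
have [S hS] : exists S : bop K H, S =1 s.
  apply: bop_exists s_lin _; exists M => y.
  have [s0|s_neq0] := eqVneq (nm (s y)) 0.
    by rewrite s0 mulr_ge0 ?nm_ge0.
  have s_gt0 : 0 < nm (s y) by rewrite lt_neqAle eq_sym s_neq0 nm_ge0.
  rewrite -(ler_pM2r s_gt0) -expr2 nm_sqE -sE.
  apply: le_trans (Re_le_nm _) _; apply: le_trans (inner_le _ _) _.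
  by rewrite mulrAC ler_wpM2r ?nm_ge0.
by exists S => x y; rewrite hS.
Qed.

Lemma adjE H K (T : bop H K) x y : '[T x, y] = '[x, adj T y].
Proof.
have [S hS] := adj_exists T.
exact: (@xgetPex _ (bop0 K H) [set S : bop K H | _] (ex_intro _ S hS) x y).
Qed.

Lemma adjEr H K (T : bop H K) x y : '[adj T x, y] = '[x, T y].
Proof. by rewrite innerC -adjE -innerC. Qed.

Lemma contraction_nm H K (T : bop H K) x :
  Defs.contraction T -> nm (T x) <= nm x.
Proof. by move=> /(_ x); rewrite !nmE lecR. Qed.

Lemma adj_contraction H K (T : bop H K) :
  Defs.contraction T -> Defs.contraction (adj T).
Proof.
move=> cT y; rewrite !nmE lecR.
have [s0|s_neq0] := eqVneq (nm (adj T y)) 0; first by rewrite s0 nm_ge0.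
have s_gt0 : 0 < nm (adj T y) by rewrite lt_neqAle eq_sym s_neq0 nm_ge0.
rewrite -(ler_pM2r s_gt0) -expr2 nm_sqE -adjE.
apply: le_trans (Re_le_nm _) _; apply: le_trans (inner_le _ _) _.
by rewrite mulrC ler_wpM2l ?nm_ge0// contraction_nm.
Qed.

(** The orthogonality relations determine the projection. *)
Lemma oproj_range H K (j : bop H K) x h :
  (forall k, '[x - j h, j k] = 0) -> oproj (range j) x = j h.
Proof.
move=> orth; rewrite /oproj; case: xgetP => [y _ [[k _ <-] yP]|/(_ (j h))].
  have jk : '[j k - j h, j (k - h)] = 0.
    have -> : j k - j h = (x - j h) - (x - j k).
      by rewrite opprB [RHS]addrC addrA subrK.
    by rewrite innerBl orth yP ?subrr//; exists (k - h).
  apply/subr0_eq/nm_le0; rewrite linearB /= inner_nm in jk.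
  move/(congr1 (@complex.Re R))/eqP: jk.
  by rewrite /= sqrf_eq0 => /eqP ->.
by case; split => [|_ [k _ <-]]; [exists h|exact: orth].
Qed.

End Adjoint.

(** * C*-algebras and their representations *)

Section CStar.
Context {R : realType} {A : cstarType R}.
Implicit Types a b c d x y : A.

Lemma cstar_mulNl a b : (- a) ** b = - (a ** b).
Proof. by rewrite -scaleN1r -cstar_scalerAl scaleN1r. Qed.
Lemma cstar_mulNr a b : a ** (- b) = - (a ** b).
Proof. by rewrite -scaleN1r -cstar_scalerAr scaleN1r. Qed.
Lemma cstar_mulBl a b c : (a - b) ** c = a ** c - b ** c.
Proof. by rewrite cstar_mulDl cstar_mulNl. Qed.
Lemma cstar_mulBr a b c : a ** (b - c) = a ** b - a ** c.
Proof. by rewrite cstar_mulDr cstar_mulNr. Qed.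

Lemma nm_mul_le a b : nm (a ** b) <= nm a * nm b.
Proof. by have := cstar_normM a b; rewrite !nmE -rmorphM lecR. Qed.

Lemma nm_starM a : nm (star a ** a) = nm a ^+ 2.
Proof. by have := cstar_normE a; rewrite !nmE -rmorphXn => /complexI. Qed.

Lemma nm_star a : nm (star a) = nm a.
Proof.
suff le b : nm b <= nm (star b) by apply/eqP; rewrite eq_le le -{2}[a]starK le.
have [->|b0] := eqVneq (nm b) 0; first exact: nm_ge0.
have b_gt0 : 0 < nm b by rewrite lt_neqAle eq_sym b0 nm_ge0.
by rewrite -(ler_pM2r b_gt0) -expr2 -nm_starM nm_mul_le.
Qed.

Lemma star1 : star (cstar_one : A) = cstar_one.
Proof.
have : star (star (cstar_one : A) ** cstar_one) = star cstar_one ** cstar_one.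
  by rewrite starM starK.
by rewrite !cstar_mulr1 starK.
Qed.

Lemma starB a b : star (a - b) = star a - star b.
Proof.
rewrite starD -[- b]scaleN1r starZ rmorphN rmorph1 scaleN1r //.
Qed.

Lemma nm_one_le1 : nm (cstar_one : A) <= 1.
Proof.
have := nm_starM (cstar_one : A); rewrite star1 cstar_mul1r.
have := nm_ge0 (cstar_one : A); nra.
Qed.

Lemma geometric_small (r e : R) : 0 <= r -> r < 1 -> 0 < e ->
  exists n, r ^+ n <= e.
Proof.
move=> r0 r1 e0.
have /cvgr0Pnorm_le/(_ e e0)[n _ hn] : (fun n => r ^+ n) @ \oo --> (0 : R).
  by apply: cvg_expr; rewrite ger0_norm.
by exists n; have := hn n (leqnn n); rewrite ger0_norm ?exprn_ge0.
Qed.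

(** The square root of [1 - b], where [b] is self-adjoint and [|b| < 1], is
    [1 - d] for the fixed point [d] of the map [d |-> (b + d ^ 2) / 2], which is
    a contraction of the ball of radius [(1 + |b|) / 2]. *)
Lemma cstar_sqrt b : star b = b -> nm b < 1 ->
  exists2 c, star c = c & cstar_one - b = c ** c.
Proof.
move=> b_sa b1; set r : R := (1 + nm b) / 2.
have nb0 := nm_ge0 b.
have r0 : 0 <= r by rewrite /r; lra.
have r1 : r < 1 by rewrite /r; lra.
pose half : R[i] := (2^-1)%:C%C.
pose phi d := half *: (b + d ** d).
pose z n := iter n phi 0.
have nmh x : nm (half *: x) = 2^-1 * nm x.
  by rewrite nmZ nm_real ger0_norm.
have sqB x y : x ** x - y ** y = x ** (x - y) + (x - y) ** y.
  by rewrite cstar_mulBr cstar_mulBl addrA subrK.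
have phiB x y : nm (phi x - phi y) <= 2^-1 * ((nm x + nm y) * nm (x - y)).
  rewrite -scalerBr nmh ler_pM2l ?invr_gt0// addrC opprD addrACA addNr add0r.
  rewrite addrC sqB; apply: le_trans (nmD _ _) _.
  have := nm_mul_le x (x - y); have := nm_mul_le (x - y) y; lra.
have z_le n : nm (z n) <= r.
  elim: n => [|n IH]; first by rewrite nm0.
  rewrite /= nmh; have := nmD b (z n ** z n); have := nm_mul_le (z n) (z n).
  have := nm_ge0 (z n); move: IH; rewrite /r; nra.
have z_star n : star (z n) = z n.
  elim: n => [|n IH]; first
    by rewrite /z/= -(scale0r (0 : A)) starZ rmorph0 !scale0r.
  by rewrite /= starZ starD starM IH b_sa conj_Creal// complex_real.
have z_cauchy n k : nm (z (n + k)%N - z n) <= r ^+ n.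
  elim: n => [|n IH]; first by rewrite subr0 expr0 (le_trans (z_le _))// ltW.
  rewrite addSn /= exprS; apply: le_trans (phiB _ _) _.
  have := z_le (n + k)%N; have := z_le n; have := nm_ge0 (z (n + k)%N - z n).
  move: IH; set t := nm (_ - _) => IH t0 h1 h2.
  apply: (@le_trans _ _ (r * t)); last by rewrite ler_wpM2l.
  rewrite mulrA ler_wpM2r//; lra.
have [d hd] : exists d, forall n, nm (d - z n) <= r ^+ n.
  apply: nested_complete => [e /(geometric_small r0 r1)//|].
  have zle j k : (j <= k)%N -> nm (z j - z k) <= r ^+ j + r ^+ k.
    move=> /subnKC <-; rewrite nmC; apply: le_trans (z_cauchy _ _) _.
    by rewrite lerDl exprn_ge0.
  move=> j k; have [/zle//|/ltnW/zle] := leqP j k.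
  by rewrite nmC [leRHS]addrC.
have limit0 x M : 0 <= M -> (forall n, nm x <= r ^+ n * M) -> x = 0.
  move=> M0 h; apply: nm_le0; apply: (le_of_eps M0) => e e0.
  have [n hn] := geometric_small r0 r1 e0.
  by rewrite add0r; apply: le_trans (h n) _; rewrite ler_wpM2r.
have d_star : star d = d.
  apply: subr0_eq; apply: (limit0 _ 2) => // n.
  rewrite -[star d](subrK (z n)) -addrA; apply: le_trans (nmD _ _) _.
  have -> : nm (star d - z n) = nm (d - z n).
    by rewrite -{1}(z_star n) -starB nm_star.
  by rewrite [nm (z n - d)]nmC mulr_natr mulr2n lerD.
have d_fix : d = phi d.
  apply: subr0_eq; apply: (limit0 _ (1 + (1 + nm d))).
    by rewrite !addr_ge0 ?nm_ge0.
  move=> n; rewrite -[d in d - _](subrK (z n.+1)) -addrA.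
  apply: le_trans (nmD _ _) _; rewrite mulrDr; apply: lerD.
    apply: le_trans (hd _) _; rewrite exprS mulrC ler_wpM2l ?exprn_ge0//.
    exact: ltW.
  apply: le_trans (phiB _ _) _; rewrite [nm (z n - d)]nmC.
  have := hd n; have := nm_ge0 (d - z n); have := z_le n; have := nm_ge0 d.
  have := nm_ge0 (z n); move: r1; set t := nm (d - z n); set rn := r ^+ n.
  set zn := nm (z n); set nd := nm d; move=> *.
  have le1 : (zn + nd) * t <= (1 + nd) * rn :> R by apply: ler_pM => //; lra.
  have le2 : 0 <= (1 + nd) * rn :> R by apply: mulr_ge0; lra.
  lra.
exists (cstar_one - d); first by rewrite starB star1 d_star.
have dd : b + d ** d = d + d.
  rewrite {3 4}d_fix -mulr2n -scaler_nat scalerA.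
  have -> : 2%:R * half = 1.
    by rewrite /half -(rmorph_nat (real_complex R)) -rmorphM mulfV.
  by rewrite scale1r.
rewrite cstar_mulBl cstar_mul1r cstar_mulBr cstar_mulr1.
rewrite -[RHS]addrA; congr (_ + _); rewrite opprB.
have -> : d ** d = d + d - b by rewrite -dd addrC addKr.
by rewrite -!addrA addKr addrCA subrr addr0.
Qed.

(** The contractivity of *-representations of C*-algebras, for algebraic
    representations on a semi-inner product space: if [|a| < 1], then
    [1 - a^* a = c^* c] is mapped to a positive operator, hence
    [|rho a u|^2 <= <rho 1 u, u> <= |u|^2]. *)
Lemma star_rep_contractive (V : Type) (add : V -> V -> V)
    (scale : R[i] -> V -> V) (B : V -> V -> R[i]) (rho : A -> V -> V) :
  semi_inner add scale B ->
  (forall a b u v, B (rho (a + b) u) v = B (rho a u) v + B (rho b u) v) ->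
  (forall (c : R[i]) a u v, B (rho (c *: a) u) v = c * B (rho a u) v) ->
  (forall a b u v, B (rho (a ** b) u) v = B (rho a (rho b u)) v) ->
  (forall a u v, B (rho a u) v = B u (rho (star a) v)) ->
  forall a u, seminorm B (rho a u) <= nm a * seminorm B u.
Proof.
move=> hB rhoD rhoZ rhoM rho_star.
have rhoB a b u v : B (rho (a - b) u) v = B (rho a u) v - B (rho b u) v.
  by rewrite rhoD -scaleN1r rhoZ mulN1r.
have sqE a u : B (rho (star a ** a) u) u = B (rho a u) (rho a u).
  by rewrite rhoM rho_star starK.
have unit_le u : complex.Re (B (rho cstar_one u) u) <= complex.Re (B u u).
  have := form_ge0 hB (vsub add scale u (rho cstar_one u)).
  rewrite (formBl hB) !(formBr hB) -sqE cstar_mulr1 star1 subrr subr0.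
  have -> : B u (rho cstar_one u) = B (rho cstar_one u) u.
    by rewrite rho_star star1.
  by rewrite !scalarE subr_ge0.
have lt1 a u : nm a < 1 -> seminorm B (rho a u) <= seminorm B u.
  move=> a1; have [||c c_sa ce] := @cstar_sqrt (star a ** a).
  - by rewrite starM starK.
  - by rewrite nm_starM expr_lt1// nm_ge0.
  rewrite -ler_sqr ?nnegrE ?seminorm_ge0// !(seminorm_sq hB).
  rewrite (le_trans _ (unit_le u))// -subr_ge0 -ReN -ReD -sqE -rhoB ce.
  by rewrite -{1}c_sa sqE; exact: form_ge0 hB _.
move=> a u; apply: (le_of_eps (seminorm_ge0 B u)) => e e0.
have na0 := nm_ge0 a.
have ne0 : 0 < nm a + e by lra.
have c0 : 0 <= (nm a + e)^-1 by rewrite invr_ge0 ltW.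
have rhoE : seminorm B (rho ((nm a + e)^-1%:C%C *: a) u) =
    (nm a + e)^-1 * seminorm B (rho a u).
  rewrite -{2}(ger0_norm c0) -nm_real -(seminormZ hB); congr Num.sqrt.
  rewrite !(formZl hB) rhoZ (formC hB _ (rho _ _)) rhoZ.
  by rewrite (formC hB _ (scale _ _)) (formZl hB).
rewrite -mulrDl -ler_pdivrMl// -rhoE; apply: lt1.
by rewrite nmZ nm_real ger0_norm// ltr_pdivrMl// mulr1 ltrDl.
Qed.
End CStar.

Section Representations.
Context {R : realType}.
Implicit Types (A : cstarType R) (H : hilbertType R).

Lemma l2norm1 H (x : 'I_1 -> H) : l2norm x = nm (x ord0).
Proof. by rewrite /l2norm big_ord1 sqrtr_sqr ger0_norm// nm_ge0. Qed.

Lemma opmx_norm1_le H (T : 'B(H)) (r : R) : 0 <= r ->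
  (forall x, nm (T x) <= r * nm x) ->
  (opmx_norm (const_mx T : 'M_1) <= r%:E)%E.
Proof.
move=> r0 hT; apply: ge_ereal_sup => _ [x /= x1 <-].
rewrite lee_fin l2norm1 big_ord1 mxE; apply: le_trans (hT _) _.
by rewrite l2norm1 in x1; rewrite ler_piMr.
Qed.

Lemma opmx_norm1_ge H (T : 'B(H)) (r : R) :
  (opmx_norm (const_mx T : 'M_1) <= r%:E)%E ->
  forall x, nm (T x) <= r * nm x.
Proof.
move=> hT x; have [x0|x_neq0] := eqVneq (nm x) 0.
  by rewrite (@nm_le0 _ _ x) ?x0// linear0 nm0 mulr0.
have x_gt0 : 0 < nm x by rewrite lt_neqAle eq_sym x_neq0 nm_ge0.
have nx y : nm ((nm x)^-1%:C%C *: y) = (nm x)^-1 * nm y.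
  by rewrite nmZ nm_real ger0_norm// invr_ge0 nm_ge0.
suff : (((nm x)^-1 * nm (T x))%:E <= r%:E)%E.
  by rewrite lee_fin ler_pdivrMl// mulrC.
apply: le_trans hT; apply: ereal_sup_ubound.
exists (fun=> (nm x)^-1%:C%C *: x); first by rewrite /= l2norm1 nx mulVf.
by rewrite l2norm1 big_ord1 mxE linearZ nx.
Qed.

Section Rep.
Variables (A : cstarType R) (H : hilbertType R) (rho : A -> 'B(H)).
Hypothesis rho_rep : representation rho.

Lemma repD a b x : rho (a + b) x = rho a x + rho b x.
Proof. by rewrite -[a in rho (a + b)]scale1r rho_rep.1 scale1r. Qed.

Lemma rep0 x : rho 0 x = 0.
Proof. by apply: (addrI (rho 0 x)); rewrite -repD !addr0. Qed.

Lemma repZ (c : R[i]) a x : rho (c *: a) x = c *: rho a x.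
Proof. by rewrite -[c *: a]addr0 rho_rep.1 rep0 addr0. Qed.

Lemma repM a b x : rho (a ** b) x = rho a (rho b x).
Proof. by rewrite rho_rep.2. Qed.

Lemma hermitian_rep_nm :
  (forall a x y, '[rho a x, y] = '[x, rho (star a) y]) ->
  forall a x, nm (rho a x) <= nm a * nm x.
Proof.
move=> rho_star a x; rewrite -!seminorm_inner.
apply: (star_rep_contractive (rho := fun a => rho a) (inner_semi H)) => //.
- by move=> *; rewrite repD innerDl.
- by move=> *; rewrite repZ innerZl.
- by move=> *; rewrite repM.
Qed.

(** Contractive representations preserve the involution. The
    idempotent [rho 1] is contractive, hence an orthogonal projection, so that
    only the vectors [x = rho 1 x] matter. For these and for a self-adjoint [b],
    the inequality [|<rho (b + i t) x, x>| <= |b + i t| * |x| ^ 2], where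
    [|b + i t| ^ 2 <= |b| ^ 2 + t ^ 2], holds for all real [t] only if
    [<rho b x, x>] is real. *)
Lemma contractive_rep_hermitian :
  (forall a x, nm (rho a x) <= nm a * nm x) ->
  forall a x y, '[rho a x, y] = '[x, rho (star a) y].
Proof.
move=> rho_nm; pose E := rho cstar_one.
(* If [E w = 0], then [|E x| <= |E x + c w|] for all scalars [c], so that [E x]
   is orthogonal to [w]. *)
have E_orth x y : '[E x, y] = '[E x, E y].
  apply/subr0_eq; rewrite -innerBr; set w := y - E y; set z := '[_, _].
  have Ew : E w = 0 by rewrite /w linearB /= -repM cstar_mulr1 subrr.
  suff z0 : nm z ^+ 2 <= 0.
    apply: nm_le0; rewrite leNgt; apply/negP => /(exprn_gt0 2).
    by rewrite ltNge z0.
  rewrite -[leRHS](mul0r (nm w ^+ 2)).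
  apply: discriminant; rewrite ?sqr_ge0// => t.
  have := rho_nm cstar_one (E x + (- t)%:C%C * z *: w).
  rewrite -/E linearD linearZ Ew /= scaler0 addr0 -repM cstar_mulr1.
  have := @nm_one_le1 _ A; set v := E x + _ => one_le1 h.
  have {}h : nm (E x) <= nm v.
    by rewrite (le_trans h)// -[leRHS]mul1r ler_wpM2r ?nm_ge0.
  move: h; rewrite -ler_sqr ?nnegrE ?nm_ge0// /v [X in _ <= X -> _]nm_sqE.
  rewrite innerDl !innerDr !innerZr !innerZl (innerC w) -/z !inner_nm nm_sq.
  rewrite !scalarE /=; lra.
have E_l b x : E (rho b x) = rho b x by rewrite -repM cstar_mul1r.
have E_r b x : rho b (E x) = rho b x by rewrite -repM cstar_mulr1.
have real_form b x : star b = b -> complex.Im '[rho b x, x] = 0.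
  move=> b_sa; rewrite -E_l E_orth E_l -E_r.
  have : E (E x) = E x by rewrite E_l.
  move: (E x) => {}x Ex; set q := complex.Im _; set n := nm x ^+ 2.
  have n0 : 0 <= n by exact: sqr_ge0.
  have main t : q ^+ 2 + 2 * q * t * n <= nm b ^+ 2 * n ^+ 2.
    pose bt := b + (t *i)%C *: cstar_one.
    have bt_nm : nm bt ^+ 2 <= nm b ^+ 2 + t ^+ 2.
      rewrite -nm_starM /bt starD starZ star1 b_sa cstar_mulDl !cstar_mulDr.
      rewrite -!cstar_scalerAl -!cstar_scalerAr cstar_mulr1 cstar_mul1r.
      rewrite cstar_mul1r scalerA.
      have -> : ((t *i)%C : R[i])^* = - (t *i)%C.
        by apply: complex_ext; rewrite /= ?oppr0.
      rewrite scaleNr addrA addrK.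
      have -> : - (t *i)%C * (t *i)%C = (t ^+ 2)%:C%C :> R[i].
        by apply: complex_ext; rewrite !scalarE /=; ring.
      apply: le_trans (nmD _ _) _; apply: lerD.
        by rewrite expr2 nm_mul_le.
      rewrite nmZ nm_real ger0_norm ?sqr_ge0// ler_piMr ?sqr_ge0//.
      exact: nm_one_le1.
    have : nm '[rho bt x, x] ^+ 2 <= (nm b ^+ 2 + t ^+ 2) * n ^+ 2.
      apply: (@le_trans _ _ (nm bt ^+ 2 * n ^+ 2)); last first.
        by rewrite ler_wpM2r ?sqr_ge0.
      rewrite -exprMn ler_sqr ?nnegrE ?mulr_ge0 ?nm_ge0//.
      apply: le_trans (inner_le _ _) _; rewrite /n expr2 mulrA.
      by rewrite ler_wpM2r ?nm_ge0.
    rewrite /bt repD repZ -/E Ex innerDl innerZl nm_sq !scalarE !inner_nm.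
    rewrite /= -/q -/n.
    have := sqr_ge0 (complex.Re '[rho b x, x] + (0 * n - t * 0)); nra.
  have qn : q * n = 0.
    apply/eqP; rewrite -sqrf_eq0 eq_le sqr_ge0 andbT.
    rewrite -[leRHS](mulr0 (nm b ^+ 2 * n ^+ 2)).
    apply: discriminant; rewrite ?sqr_ge0//.
      exact: mulr_ge0 (sqr_ge0 _) (sqr_ge0 _).
    move=> t; have := main (t * (q * n)); have := sqr_ge0 q; nra.
  have /orP[/eqP//|] : (q == 0) || (n == 0) by rewrite -mulf_eq0 qn.
  rewrite sqrf_eq0 => /eqP x0; rewrite /q (@nm_le0 _ _ x) ?x0//.
  by rewrite linear0.
(* Polarization: the form is real at [x + y] and at [x + i y]. *)
have sa b x y : star b = b -> '[rho b x, y] = '[x, rho b y].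
  move=> b_sa.
  have := real_form b (x + y) b_sa; have := real_form b (x + 'i%C *: y) b_sa.
  have := real_form b x b_sa; have := real_form b y b_sa.
  rewrite ![rho b (_ + _)]linearD ![rho b (_ *: _)]linearZ.
  rewrite !innerDl !innerDr !innerZl !innerZr.
  rewrite (innerC x) !scalarE /= => *.
  by apply: complex_ext; rewrite !scalarE; lra.
move=> a x y.
have i_conj : (- 'i%C : R[i])^* = 'i%C.
  by apply: complex_ext; rewrite !scalarE /= ?opprK// oppr0.
have h_sa : star (a + star a) = a + star a by rewrite starD starK addrC.
have k_sa : star (- 'i%C *: (a - star a)) = - 'i%C *: (a - star a) :> A.
  by rewrite starZ starB starK -opprB scalerN -scaleNr i_conj.
have := sa _ x y h_sa; have := sa _ x y k_sa.
rewrite !(repZ _ (a - _)) -[- star a]scaleN1r !repD !(repZ _ (star a)).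
rewrite !scaleN1r.
rewrite innerZl innerZr i_conj innerBl innerBr innerDl innerDr.
set P := '[rho a x, y]; set Q := '[rho (star a) x, y].
set P' := '[x, rho a y]; set Q' := '[x, rho (star a) y] => k h.
have {}k : P - Q = Q' - P'.
  have i0 : - 'i%C != 0 :> R[i].
    by rewrite oppr_eq0 eq_complex /= oner_eq0 andbF.
  by apply: (mulfI i0); rewrite k; ring.
have two0 : 2 != 0 :> R[i] by rewrite pnatr_eq0.
apply: (mulfI two0).
have -> : 2 * P = (P + Q) + (P - Q) by ring.
by rewrite h k; ring.
Qed.

End Rep.

Lemma star_rep_nm A H (rho : A -> 'B(H)) : star_representation rho ->
  forall a x, nm (rho a x) <= nm a * nm x.
Proof.
move=> [rho_rep rho_star]; apply: hermitian_rep_nm => // a x y.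
by rewrite rho_star -adjE.
Qed.

(** For [1 * 1] matrices the C*-norm given by all representations is bounded by
    the norm of the algebra, since *-representations are contractive. *)
Lemma cmx_norm1_le A (a : A) : (cmx_norm (const_mx a : 'M_1) <= (nm a)%:E)%E.
Proof.
apply: ge_ereal_sup => _ [H [rho [rho_star ->]]]; rewrite map_const_mx.
by apply: opmx_norm1_le; [exact: nm_ge0|exact: star_rep_nm].
Qed.

(** The map [f] is meant to be an [alpha_s]. As it preserves the C*-norms, which
    are computed in the representations of the algebra, [f a] is compared with
    [a] without recourse to a faithful representation. *)
Lemma completely_contractive_nm A H (rho : A -> 'B(H)) (f : A -> A) :
  completely_contractive rho -> completely_isometric f ->
  forall a x, nm (rho (f a) x) <= nm a * nm x.
Proof.
move=> rho_cc f_ci a; apply: opmx_norm1_ge.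
rewrite -map_const_mx; apply: le_trans (rho_cc _ _) _.
by rewrite -map_const_mx f_ci cmx_norm1_le.
Qed.

(** The C*-norm of matrices is a supremum over all *-representations. *)
Lemma star_rep_completely_contractive A H (rho : A -> 'B(H)) :
  star_representation rho -> completely_contractive rho.
Proof.
by move=> rho_star n a; apply: ereal_sup_ubound; exists H, rho.
Qed.
End Representations.

(** * The completion of a semi-inner product space *)

Section Completion.
Context {R : realType} {V : Type} {add : V -> V -> V}
  {scale : R[i] -> V -> V} {B : V -> V -> R[i]}.
Implicit Types (f : V -> R[i]) (v w : V).

Definition approx f v (e : R) :=
  forall w, nm (f w - B v w) <= e * seminorm B w.

Lemma approx_form v d : 0 <= d -> approx (B v) v d.
Proof. by move=> d0 w; rewrite subrr nm0 mulr_ge0 ?seminorm_ge0. Qed.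

Definition approximable : {pred V -> R[i]} :=
  fun f => `[< forall e, 0 < e -> exists v, approx f v e >].

Lemma approximableP f : reflect (forall e, 0 < e -> exists v, approx f v e)
  (f \in approximable).
Proof. exact: asboolP. Qed.

(** The Hilbert space generated by a semi-inner product space [V]: the uniform
    closure of the functionals [<v, _>] in the space of functions on [V]. The
    vectors of seminorm zero give the functional zero, so that no quotient is
    needed. *)
Record completion (hB : semi_inner add scale B) := Completion {
  completion_fun :> V -> R[i];
  _ : completion_fun \in approximable
}.

Variable hB : semi_inner add scale B.

HB.instance Definition _ := [isSub for @completion_fun hB].
HB.instance Definition _ := [Choice of completion hB by <:].

Lemma approxD f g u v d e : approx f u d -> approx g v e ->
  approx (f + g) (add u v) (d + e).
Proof.
move=> fu gv w; rewrite (formDl hB) opprD addrACA mulrDl.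
by apply: le_trans (nmD _ _) _; apply: lerD; [exact: fu|exact: gv].
Qed.

Lemma approxZ c f v d : approx f v d -> approx (c *: f) (scale c v) (nm c * d).
Proof.
move=> fv w; rewrite (formZl hB) -[(c *: f) w]/(c * f w) -mulrBr nmM -mulrA.
by rewrite ler_wpM2l ?nm_ge0.
Qed.

Lemma approximable_submod : submod_closed approximable.
Proof.
split=> [|c f g /approximableP hf /approximableP hg];
  apply/approximableP => e e0.
  have [v] := form_inhabited hB; exists (scale 0 v) => w.
  by rewrite (formZl hB) mul0r subr0 nm0 mulr_ge0 ?seminorm_ge0// ltW.
have c0 : 0 < nm c + 1 by rewrite ltr_wpDl ?nm_ge0.
have d0 : 0 < e / (nm c + 1) by rewrite divr_gt0.
have [[v fv] [w gw]] := (hf _ d0, hg _ d0).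
exists (add (scale c v) w); have := approxD (approxZ c fv) gw.
suff -> : nm c * (e / (nm c + 1)) + e / (nm c + 1) = e by [].
by rewrite -{2}[e / _]mul1r -mulrDl mulrC divfK// gt_eqF.
Qed.

HB.instance Definition _ :=
  GRing.isSubmodClosed.Build _ _ approximable approximable_submod.
HB.instance Definition _ := [SubChoice_isSubLmodule of completion hB by <:].

Local Notation K := (completion hB).
Local Notation N := (seminorm B).
Implicit Types (g h k : K).

Lemma completion_ext g h : g =1 h -> g = h.
Proof. by move=> gh; apply/val_inj/funext. Qed.

Lemma completionD g h v : (g + h) v = g v + h v. Proof. by []. Qed.
Lemma completionZ c g v : (c *: g) v = c * g v. Proof. by []. Qed.
Lemma completionN g v : (- g) v = - g v. Proof. by []. Qed.

Lemma completion_approx g e : 0 < e -> exists v, approx g v e.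
Proof. by move: e; apply/approximableP; case: g. Qed.

Lemma form_approximable v : B v \in approximable.
Proof.
by apply/approximableP => e e0; exists v; apply: approx_form; rewrite ltW.
Qed.
Definition embed v : K := Completion hB (form_approximable v).

Lemma completion_bounded g : exists2 M, 0 <= M & forall w, nm (g w) <= M * N w.
Proof.
have [v gv] := completion_approx g ltr01; exists (1 + N v) => [|w].
  by rewrite addr_ge0 ?seminorm_ge0.
rewrite -(subrK (B v w) (g w)) mulrDl; apply: le_trans (nmD _ _) _.
by apply: lerD; [exact: gv|exact: cauchy_schwarz hB v w].
Qed.

Lemma eq_of_small (z : R[i]) c : 0 <= c ->
  (forall e, 0 < e -> e <= 1 -> nm z <= e * c) -> z = 0.
Proof.
move=> c0 hz; apply: nm_le0; apply: (le_of_eps c0) => e e0; rewrite add0r.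
have [e1|/ltW e1] := leP e 1; first exact: hz.
by apply: le_trans (hz 1 ltr01 (lexx _)) _; rewrite ler_wpM2r.
Qed.

Lemma completionDr g v w : g (add v w) = g v + g w.
Proof.
apply: subr0_eq; apply: (@eq_of_small _ (N (add v w) + N v + N w)).
  by rewrite !addr_ge0 ?seminorm_ge0.
move=> e e0 _; have [u gu] := completion_approx g e0.
have -> : g (add v w) - (g v + g w) =
    (g (add v w) - B u (add v w)) - (g v - B u v) - (g w - B u w).
  by rewrite (formDr hB); ring.
have := gu (add v w); have := gu v; have := gu w.
set x := g (add v w) - _; set y := g v - _; set z := g w - _.
have := nmB (x - y) z; have := nmB x y; lra.
Qed.

Lemma completionZr g c v : g (scale c v) = c^* * g v.
Proof.
apply: subr0_eq; apply: (@eq_of_small _ (N (scale c v) + nm c * N v)).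
  by rewrite addr_ge0 ?mulr_ge0 ?seminorm_ge0 ?nm_ge0.
move=> e e0 _; have [u gu] := completion_approx g e0.
have -> : g (scale c v) - c^* * g v =
    (g (scale c v) - B u (scale c v)) - c^* * (g v - B u v).
  by rewrite (formZr hB); ring.
have := gu (scale c v); have := ler_wpM2l (nm_ge0 c) (gu v).
set x := g (scale c v) - _; set y := g v - _.
have := nmB x (c^* * y); rewrite nmM nm_conj; lra.
Qed.

Lemma completionBr g v w : g (vsub add scale v w) = g v - g w.
Proof. by rewrite completionDr completionZr rmorphN rmorph1 mulN1r. Qed.

(** Functionals in the completion do not distinguish equivalent vectors. This is
    how identities between operators are checked on [V]. *)
Lemma completion_eqr g v w : (forall u, B u v = B u w) -> g v = g w.
Proof.
move=> vw; apply: subr0_eq; apply: (@eq_of_small _ (N v + N w)).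
  by rewrite addr_ge0 ?seminorm_ge0.
move=> e e0 _; have [u gu] := completion_approx g e0.
have := gu v; have := gu w; have := nmB (g v - B u v) (g w - B u w).
by rewrite vw opprB addrA subrK; lra.
Qed.

Lemma approx_dist g v w d e : 0 <= d -> 0 <= e ->
  approx g v d -> approx g w e -> N (vsub add scale v w) <= d + e.
Proof.
move=> d0 e0 gv gw; apply: (seminorm_le hB); first exact: addr_ge0.
move=> u; rewrite (formBl hB).
have -> : B v u - B w u = (g u - B w u) - (g u - B v u) by ring.
by apply: le_trans (nmB _ _) _; rewrite mulrDl addrC lerD.
Qed.

(** The inner product of [g] and [h] is the limit of the values [g v] when [v]
    approximates [h]. *)
Lemma inner_exists g h : exists c, exists2 M, 0 <= M &
  forall v d, 0 <= d -> approx h v d -> nm (c - g v) <= M * d.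
Proof.
have [M M0 hM] := completion_bounded g.
pose J := {p : V * R | 0 <= p.2 /\ approx h p.1 p.2}.
have [v0 hv0] := completion_approx h ltr01.
pose j0 : J := exist _ (v0, 1) (conj ler01 hv0).
have [|c hc] := @nested_complex R J j0 (fun j => g (sval j).1)
    (fun j => M * (sval j).2).
  move=> [[v d] /= [d0 hv]] [[w e] /= [e0 hw]]; rewrite -completionBr -mulrDr.
  by apply: le_trans (hM _) _; rewrite ler_wpM2l// (approx_dist d0 e0 hv hw).
exists c; exists (2 * M) => [|v d d0 hv]; first by rewrite mulr_ge0.
by rewrite -mulrA; exact: hc (exist _ (v, d) (conj d0 hv)).
Qed.

Definition cinner g h : R[i] := sval (cid (inner_exists g h)).

Lemma cinnerP g h : exists2 M, 0 <= M &
  forall v d, 0 <= d -> approx h v d -> nm (cinner g h - g v) <= M * d.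
Proof. by rewrite /cinner; case: cid. Qed.

Lemma cinner_unique g h c M : 0 <= M ->
  (forall v d, 0 < d -> d <= 1 -> approx h v d -> nm (c - g v) <= M * d) ->
  cinner g h = c.
Proof.
move=> M0 hc; have [M' M'0 hM'] := cinnerP g h.
apply: subr0_eq; apply: (@eq_of_small _ (M' + M)); first exact: addr_ge0.
move=> e e0 e1; have [v hv] := completion_approx h e0.
have := hM' v e (ltW e0) hv; have := hc v e e0 e1 hv.
have := nmB (cinner g h - g v) (c - g v); rewrite opprB addrA subrK; lra.
Qed.

Lemma cinner_embed g v : cinner g (embed v) = g v.
Proof.
have [M M0 hM] := cinnerP g (embed v); apply/subr0_eq/nm_le0.
by have := hM v 0 (lexx 0) (approx_form v (lexx 0)); rewrite mulr0.
Qed.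

Lemma approx_le g v d M : 0 <= d -> 0 <= M ->
  (forall w, nm (g w) <= M * N w) -> approx g v d -> N v <= M + d.
Proof.
move=> d0 M0 hM gv; apply: (seminorm_le hB); first exact: addr_ge0.
move=> u; have -> : B v u = g u - (g u - B v u) by ring.
by apply: le_trans (nmB _ _) _; rewrite mulrDl lerD.
Qed.

Lemma cinner_semi : semi_inner +%R *:%R cinner.
Proof.
split.
- exact: inhabits 0.
- move=> g h k; have [M M0 hM] := cinnerP g k; have [P P0 hP] := cinnerP h k.
  apply: (@cinner_unique _ _ _ (M + P)); first exact: addr_ge0.
  move=> v d /ltW d0 _ kv; rewrite completionD opprD addrACA mulrDl.
  by apply: le_trans (nmD _ _) _; rewrite lerD ?hM ?hP.
- move=> c g k; have [M M0 hM] := cinnerP g k.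
  apply: (@cinner_unique _ _ _ (nm c * M)); first by rewrite mulr_ge0 ?nm_ge0.
  move=> v d /ltW d0 _ kv; rewrite completionZ -mulrBr nmM -mulrA.
  by rewrite ler_wpM2l ?nm_ge0 ?hM.
- move=> g h; have [M M0 hM] := cinnerP h g.
  have [P P0 hP] := completion_bounded g.
  have [Q Q0 hQ] := completion_bounded h.
  apply: (@cinner_unique _ _ _ (M + (P + 1) + (Q + 1))).
    by rewrite !addr_ge0.
  move=> w d d_gt0 d1 hw; have d0 := ltW d_gt0.
  have [v gv] := completion_approx g d_gt0.
  have -> : (cinner h g)^* - g w = (cinner h g - h v)^* + (h v - B w v)^* -
      (g w - B v w).
    by rewrite !rmorphB /= -(formC hB); ring.
  have Nv := approx_le d0 P0 hP gv; have Nw := approx_le d0 Q0 hQ hw.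
  have := hM v d d0 gv; have := hw v; have := gv w.
  set x := cinner _ _ - _; set y := h v - _; set z := g w - _.
  have := nmB (x^* + y^*) z; have := nmD x^* y^*; rewrite !nm_conj; nra.
- move=> g; have [M M0 hM] := cinnerP g g.
  have [P P0 hP] := completion_bounded g.
  apply: (@le_of_eps _ _ _ (M + P + 1)); first by rewrite !addr_ge0.
  move=> e e_gt0; have d_gt0 : 0 < Num.min e 1 by rewrite lt_min e_gt0 ltr01.
  have [v gv] := completion_approx g d_gt0.
  have := hM v _ (ltW d_gt0) gv; have := gv v.
  have Nv := approx_le (ltW d_gt0) P0 hP gv; have Bvv := form_ge0 hB v.
  have d_le1 : Num.min e 1 <= 1 by rewrite ge_min lexx orbT.
  have d_lee : Num.min e 1 <= e by rewrite ge_min lexx.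
  move: d_gt0 Nv d_le1 d_lee; set d := Num.min e 1 => d_gt0 Nv d_le1 d_lee.
  have := normRe_le_nm (g v - B v v); have := normRe_le_nm (cinner g g - g v).
  rewrite !scalarE => /ler_normlP[h1 _] /ler_normlP[h2 _] h3 h4.
  have N0 := seminorm_ge0 B v.
  have : d * N v <= e * (P + 1) by apply: ler_pM => //; lra.
  have : M * d <= M * e by rewrite ler_wpM2l.
  lra.
Qed.

Lemma cinner_eq0 g : complex.Re (cinner g g) = 0 -> g = 0.
Proof.
move=> g0; apply: completion_ext => v; rewrite -cinner_embed; apply: nm_le0.
apply: le_trans (cauchy_schwarz cinner_semi _ _) _.
by rewrite /seminorm g0 sqrtr0 mul0r.
Qed.

Definition cnorm g : R[i] := (seminorm cinner g)%:C%C.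

Lemma cnormD g h : cnorm (g + h) <= cnorm g + cnorm h.
Proof. by rewrite -rmorphD lecR; exact: (seminormD cinner_semi). Qed.

Lemma cnormZ c g : cnorm (c *: g) = `|c| * cnorm g.
Proof. by rewrite /cnorm (seminormZ cinner_semi) nmE -rmorphM. Qed.

Lemma cnorm_eq0 g : cnorm g = 0 -> g = 0.
Proof.
move=> /complexI g0; apply: cinner_eq0.
by rewrite -(seminorm_sq cinner_semi) g0 expr0n.
Qed.

HB.instance Definition _ :=
  Lmodule_isNormed.Build R[i] K cnormD cnormZ cnorm_eq0.

Lemma completion_nm g : nm g = seminorm cinner g. Proof. by []. Qed.

Lemma nm_embed v : nm (embed v) = N v.
Proof. by rewrite completion_nm /seminorm cinner_embed. Qed.

Lemma completion_le g v : nm (g v) <= nm g * N v.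
Proof.
rewrite -cinner_embed; apply: le_trans (cauchy_schwarz cinner_semi _ _) _.
by rewrite -!completion_nm nm_embed.
Qed.

(** The norm of the completion is the norm of functionals. *)
Lemma completion_nm_le g M : 0 <= M -> (forall v, nm (g v) <= M * N v) ->
  nm g <= M.
Proof.
move=> M0 hM; rewrite -ler_sqr ?nnegrE ?nm_ge0//.
rewrite completion_nm (seminorm_sq cinner_semi).
have [P P0 hP] := cinnerP g g.
apply: (@le_of_eps _ _ _ (M + P)); first exact: addr_ge0.
move=> e e0; have [v gv] := completion_approx g e0.
have := hP v e (ltW e0) gv; have := approx_le (ltW e0) M0 hM gv; have := hM v.
have := Re_le_nm (cinner g g); have := nmD (cinner g g - g v) (g v).
rewrite subrK; set x := nm _; set y := nm _ => *; nra.
Qed.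

Lemma approx_nm g v e : 0 <= e -> approx g v e -> nm (g - embed v) <= e.
Proof. by move=> e0 gv; apply: completion_nm_le. Qed.

Lemma completion_complete (F : set_system K) : ProperFilter F -> cauchy F ->
  cvg F.
Proof.
move=> FF /cauchyP Fc.
(* Balls that belong to the filter; any two of them intersect. *)
pose J := {p : K * R | 0 < p.2 /\ F (ball p.1 (p.2)%:C%C)}.
have near e : 0 < e -> exists j : J, (sval j).2 = e.
  move=> e0; have [|f Ff] := Fc e%:C%C _; first by rewrite ltcR.
  by exists (exist _ (f, e) (conj e0 Ff)).
have [j0 _] := near 1 ltr01.
have ballE (f k : K) (e : R) : ball f e%:C%C k -> nm (f - k) < e.
  by rewrite -ball_normE /= nmE ltcR.
have lim v :
    exists c, forall j : J, nm (c - (sval j).1 v) <= 2 * ((sval j).2 * N v).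
  apply: (nested_complex j0) => [] [[f d] /= [d0 Ff]] [[k e] /= [e0 Fk]].
  have [u [/ballE fu /ballE ku]] := filter_ex (filterI Ff Fk).
  rewrite -mulrDl; have -> : f v - k v = (f - u) v - (k - u) v.
    by rewrite !completionD !completionN; ring.
  apply: le_trans (nmB _ _) _; rewrite mulrDl; apply: lerD.
    apply: le_trans (completion_le _ _) _.
    by rewrite ler_wpM2r ?seminorm_ge0 ?ltW.
  apply: le_trans (completion_le _ _) _.
  by rewrite ler_wpM2r ?seminorm_ge0 ?ltW.
pose g v := sval (cid (lim v)).
have gP v (j : J) : nm (g v - (sval j).1 v) <= 2 * ((sval j).2 * N v).
  by rewrite /g; case: cid.
have g_app : g \in approximable.
  apply/approximableP => e e0; have e4 : 0 < e / 4 by rewrite divr_gt0.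
  have [j je] := near _ e4; have [v fv] := completion_approx (sval j).1 e4.
  exists v => w; have := gP w j; have := fv w; rewrite je.
  have := nmD (g w - (sval j).1 w) ((sval j).1 w - B v w).
  rewrite addrA subrK; have := mulr_ge0 (ltW e0) (seminorm_ge0 B w); lra.
apply/cvg_ex; exists (Completion hB g_app); apply/fcvgrPdist_lt => e.
rewrite ltcE => /andP[/eqP/= e_real e0].
have -> : e = (complex.Re e)%:C%C by apply: complex_ext.
have e4 : 0 < complex.Re e / 4 by rewrite divr_gt0.
have [j je] := near _ e4; have [_] := svalP j; rewrite je.
apply: filterS => k /ballE fk; rewrite nmE ltcR.
have : nm (Completion hB g_app - (sval j).1) <= 2 * (complex.Re e / 4).
  apply: completion_nm_le; first by rewrite mulr_ge0// ltW.
  by move=> v; have := gP v j; rewrite je mulrA.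
have := nmD (Completion hB g_app - (sval j).1) ((sval j).1 - k).
rewrite addrA subrK; lra.
Qed.

HB.instance Definition _ := Uniform_isComplete.Build K completion_complete.

HB.instance Definition _ := @bilinear_isBilinear.Build R[i] K K R[i]
  *%R (Num.conj \; *%R) cinner
  (fun h c g k => etrans (formDl cinner_semi _ _ _)
     (congr1 (+%R^~ _) (formZl cinner_semi _ _ _)),
   fun h c g k => etrans (formDr cinner_semi _ _ _)
     (congr1 (+%R^~ _) (formZr cinner_semi _ _ _))).

Lemma cinner_herm g h : cinner g h = (-1) ^+ false * Num.conj (cinner h g).
Proof. by rewrite expr0 mul1r (formC cinner_semi). Qed.

HB.instance Definition _ := @isHermitianSesquilinear.Build R[i] K false
  (@Num.conj R[i]) cinner cinner_herm.

Lemma cinner_gt0 g : g != 0 -> 0 < cinner g g.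
Proof.
move=> g0; rewrite (formE cinner_semi) ltcR -completion_nm exprn_gt0//.
rewrite lt_neqAle nm_ge0 andbT; apply: contra g0 => /eqP g0.
by rewrite (@nm_le0 _ _ g)// -g0.
Qed.

HB.instance Definition _ := @isDotProduct.Build R[i] K cinner cinner_gt0.

Lemma cinner_normE g : `|g| ^+ 2 = cinner g g.
Proof. by rewrite nmE -rmorphXn (formE cinner_semi). Qed.

HB.instance Definition _ := @CompleteNormedModule_isHilbert.Build R K
  cinner cinner_normE.

Lemma inner_embed g v : '[g, embed v] = g v.
Proof. exact: cinner_embed. Qed.

(** An operator [L] with an adjoint [L'] acts on functionals by precomposition
    with [L'], because [<L v, w> = <v, L' w>]. *)
Section Lift.
Variables (L L' : V -> V) (M : R).
Hypothesis L_adj : forall v w, B (L v) w = B v (L' w).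
Hypothesis L'_le : forall v, N (L' v) <= M * N v.

Lemma lift_approximable g : (fun v => g (L' v)) \in approximable.
Proof.
have M0 : 0 <= `|M| by [].
apply/approximableP => e e0; have d0 : 0 < e / (`|M| + 1).
  by rewrite divr_gt0// ltr_wpDl.
have [v gv] := completion_approx g d0; exists (L v) => w.
rewrite L_adj; apply: le_trans (gv _) _; rewrite -mulrA ler_pM2l//.
rewrite mulrC ler_pdivrMr ?ltr_wpDl//; apply: le_trans (L'_le _) _.
rewrite mulrC ler_wpM2l ?seminorm_ge0//; have := ler_norm M; lra.
Qed.

Lemma lift_exists : exists T : 'B(K), forall g v, T g v = g (L' v).
Proof.
pose T g := Completion hB (lift_approximable g).
have [S hS] : exists S : 'B(K), S =1 T.
  apply: bop_exists => [c g h|]; first exact: completion_ext.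
  exists `|M| => g; apply: completion_nm_le; first by rewrite mulr_ge0 ?nm_ge0.
  move=> v; apply: le_trans (completion_le g (L' v)) _; rewrite [`|M| * _]mulrC.
  rewrite -mulrA ler_wpM2l ?nm_ge0//; apply: le_trans (L'_le _) _.
  by rewrite ler_wpM2r ?seminorm_ge0// ler_norm.
by exists S => g v; rewrite hS.
Qed.

End Lift.

End Completion.

(** * The direct sum of cones *)

Section DirectSumCone.
Context {R : realType} {I : choiceType} {S : I -> set R}.
Hypothesis S_nneg : forall i x, S i x -> 0 <= x.
Hypothesis S_zero : forall i, S i 0.
Hypothesis S_add : forall i x y, S i x -> S i y -> S i (x + y).
Hypothesis S_cone : forall i,
  S i = [set x - y | x in S i & y in S i] `&` [set x | 0 <= x].
Implicit Types (s t u : I -> R) (F : seq I) (i j : I).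

Lemma S_sub i x y : S i x -> S i y -> y <= x -> S i (x - y).
Proof.
move=> Sx Sy yx; rewrite S_cone; split; last by rewrite /= subr_ge0.
by exists x => //; exists y.
Qed.

(** In the lattice group generated by the direct sum, [excess s t] is the
    positive part of [s - t]. *)
Definition excess s t : I -> R := fun i => s i - Num.min (s i) (t i).
Definition single i (x : R) : I -> R := fun j => if j == i then x else 0.
Definition restr F s : I -> R := fun i => if i \in F then s i else 0.

Lemma excess_le s t i : s i <= t i -> excess s t i = 0.
Proof. by move=> st; rewrite /excess min_l// subrr. Qed.

Lemma excess_ge s t i : t i <= s i -> excess s t i = s i - t i.
Proof. by move=> ts; rewrite /excess min_r. Qed.

Lemma dsum_nneg s i : dsum S s -> 0 <= s i.
Proof. by move=> [Ss _]; exact: S_nneg (Ss i). Qed.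

Lemma dsum0 : dsum S 0.
Proof.
by split => //; apply: sub_finite_set (finite_set0 I) => i; rewrite /= eqxx.
Qed.

Lemma dsumD s t : dsum S s -> dsum S t -> dsum S (s + t).
Proof.
move=> [Ss fs] [St ft]; split => [i|]; first exact: S_add.
have ft2 : finite_set ([set i | s i != 0] `|` [set i | t i != 0]).
  by rewrite finite_setU.
apply: sub_finite_set ft2 => i /=; rewrite -[(s + t) i]/(s i + t i) => st0.
have [si|] := eqVneq (s i) 0; last by left.
by right; apply: contra_neq st0 => ti; rewrite si ti addr0.
Qed.

Lemma dsum_excess s t : dsum S s -> dsum S t -> dsum S (excess s t).
Proof.
move=> ds dt; split => [i|].
  have [st|/ltW ts] := leP (s i) (t i); first by rewrite excess_le.
  by rewrite excess_ge//; apply: S_sub => //; [exact: ds.1|exact: dt.1].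
apply: sub_finite_set ds.2 => i /=; apply: contra_neq => s0.
by rewrite excess_le// s0 (dsum_nneg _ dt).
Qed.

Lemma dsum_restr F s : dsum S s -> dsum S (restr F s).
Proof.
move=> ds; split => [i|].
  by rewrite /restr; case: ifP => // _; exact: ds.1.
by apply: sub_finite_set ds.2 => i /=; rewrite /restr; case: ifP => // _ /eqP.
Qed.

Lemma dsum_single i x : S i x -> dsum S (single i x).
Proof.
move=> Sx; split => [j|]; first by rewrite /single; case: eqP => // ->.
apply: sub_finite_set (finite_set1 i) => j /=; rewrite /single.
by have [//|_] := eqVneq j i; rewrite eqxx.
Qed.

Lemma summand_single i x : S i x -> summand S i (single i x).
Proof.
move=> Sx; split; first exact: dsum_single.
by move=> j /eqP/negPf; rewrite /single => ->.
Qed.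

Lemma single0 i : single i 0 = 0.
Proof. by apply/funext => j; rewrite /single; case: eqP. Qed.

Lemma singleD i x y : single i (x + y) = single i x + single i y.
Proof.
by apply/funext => j; rewrite -[RHS]/(single i x j + single i y j) /single;
  case: eqP => // _; rewrite addr0.
Qed.

Lemma restr_cons i F s : i \notin F ->
  restr (i :: F) s = single i (s i) + restr F s.
Proof.
move=> iF; apply/funext => j; rewrite -[RHS]/(single i (s i) j + restr F s j).
rewrite /restr /single inE; case: eqP => [->|_] /=; last by rewrite add0r.
by rewrite (negPf iF) addr0.
Qed.

Lemma dsum_restr_id s : dsum S s -> exists F, restr F s = s.
Proof.
move=> [_ /finite_seqP[F hF]]; exists F; apply/funext => i; rewrite /restr.
case: ifP => // /negP iF; apply/esym/eqP; apply: contra_notT iF => si.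
by have : [set i | s i != 0] i by []; rewrite hF.
Qed.

Lemma dsum_ind (P : (I -> R) -> Prop) : P 0 ->
  (forall i x s, S i x -> dsum S s -> s i = 0 -> P s -> P (single i x + s)) ->
  forall s, dsum S s -> P s.
Proof.
move=> P0 PS s ds; have [F <-] := dsum_restr_id ds.
elim: F => [|i F IH].
  by have -> : restr [::] s = 0 by apply/funext => i.
have [iF|iF] := boolP (i \in F).
  have -> : restr (i :: F) s = restr F s; last by [].
  by apply/funext => j; rewrite /restr inE; case: eqP => //= ->; rewrite iF.
rewrite restr_cons//; apply: PS => //; [exact: ds.1|exact: dsum_restr|].
by rewrite /restr (negPf iF).
Qed.

(** * Nica-covariant contractive representations *)

Section Nica.
Context {H : hilbertType R} {T : (I -> R) -> 'B(H)}.
Hypothesis T_rep : semigroup_representation S T.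
Hypothesis T_nica : nica_covariant S T.
Hypothesis T_contr : forall s, dsum S s -> Defs.contraction (T s).

Lemma T0 h : T 0 h = h. Proof. by rewrite T_rep.1. Qed.

Lemma TD s t h : dsum S s -> dsum S t -> T (s + t) h = T s (T t h).
Proof. by move=> ds dt; rewrite T_rep.2. Qed.

Lemma TC s t h : dsum S s -> dsum S t -> T s (T t h) = T t (T s h).
Proof. by move=> ds dt; rewrite -!TD// addrC. Qed.

Lemma T_nm s h : dsum S s -> nm (T s h) <= nm h.
Proof. by move=> ds; apply/contraction_nm/T_contr. Qed.

Lemma adjT0 h : adj (T 0) h = h.
Proof. by apply: inner_injr => g; rewrite -adjE T0. Qed.

Lemma adjTD s t h : dsum S s -> dsum S t ->
  adj (T (s + t)) h = adj (T t) (adj (T s) h).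
Proof. by move=> ds dt; apply: inner_injr => g; rewrite -!adjE TD. Qed.

Lemma nica_single i x t h : S i x -> dsum S t -> t i = 0 ->
  adj (T (single i x)) (T t h) = T t (adj (T (single i x)) h).
Proof.
move=> Sx dt; elim/dsum_ind: dt h => [h _|j y s Sy ds sj IH h].
  by rewrite !T0.
rewrite -[(single j y + s) i]/(single j y i + s i) => /eqP.
rewrite paddr_eq0 ?(dsum_nneg _ ds) ?(dsum_nneg _ (dsum_single Sy))//.
have dy := dsum_single Sy; move=> /andP[/eqP yi /eqP si]; rewrite !TD//.
rewrite -IH//; move: yi; rewrite {1}/single; case: eqP => [ij y0|/eqP ij _].
  by rewrite y0 !single0 !T0.
by rewrite [LHS](T_nica _ (summand_single Sx) (summand_single Sy))//; exact/eqP.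
Qed.

(** Nica covariance is assumed for elements of two distinct summands; both
    elements are decomposed into their coordinates. *)
Lemma nica_disjoint s t h : dsum S s -> dsum S t ->
  (forall i, s i = 0 \/ t i = 0) -> adj (T s) (T t h) = T t (adj (T s) h).
Proof.
move=> ds dt; elim/dsum_ind: ds h => [h _|i x u Sx du ui IH h st].
  by rewrite !adjT0.
have dx := dsum_single Sx; rewrite !adjTD//.
have ut j : u j = 0 \/ t j = 0.
  have [sj|tj] := st j; [left|by right].
  move: sj; rewrite -[(_ + u) j]/(single i x j + u j) => /eqP.
  by rewrite paddr_eq0 ?(dsum_nneg _ dx) ?(dsum_nneg _ du)// => /andP[_ /eqP].
have [|ti] := st i; last by rewrite nica_single// IH.
rewrite -[(_ + u) i]/(single i x i + u i) ui addr0 {1}/single eqxx => x0.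
by rewrite x0 single0 !adjT0 IH.
Qed.

(** * The positive definite kernel *)

Definition cone := {s : I -> R | dsum S s}.
Implicit Types (x y : cone * H) (v w : seq (cone * H)).

(** The kernel that only sees the coordinates in [F]; it is the object of the
    induction on the coordinates. *)
Definition kernel F x y : R[i] :=
  '[T (restr F (excess (sval x.1) (sval y.1))) x.2,
    T (restr F (excess (sval y.1) (sval x.1))) y.2].

Definition kform (k : cone * H -> cone * H -> R[i]) v w : R[i] :=
  \sum_(x <- v) \sum_(y <- w) k x y.

Definition scalev (c : R[i]) v := [seq (x.1, c *: x.2) | x <- v].
Definition mapv (f : H -> H) v := [seq (x.1, f x.2) | x <- v].

Lemma formv_catl k v v' w : kform k (v ++ v') w = kform k v w + kform k v' w.
Proof. by rewrite /kform big_cat. Qed.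

Lemma form_herm k : (forall x y, k x y = (k y x)^*) ->
  forall v w, kform k v w = (kform k w v)^*.
Proof.
move=> k_herm v w; rewrite /kform rmorph_sum exchange_big /=.
apply: eq_bigr => y _; rewrite rmorph_sum /=; apply: eq_bigr => x _.
exact: k_herm.
Qed.

Lemma form_adj (k k' : cone * H -> cone * H -> R[i])
    (f g : cone * H -> cone * H) v w :
  (forall x y, k (f x) y = k' x (g y)) ->
  kform k (map f v) w = kform k' v (map g w).
Proof.
move=> fg; rewrite /kform big_map; apply: eq_bigr => x _.
by rewrite big_map; apply: eq_bigr.
Qed.

Lemma form_map (k k' : cone * H -> cone * H -> R[i])
    (f g : cone * H -> cone * H) v w :
  (forall x y, k (f x) (g y) = k' x y) ->
  kform k (map f v) (map g w) = kform k' v w.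
Proof.
move=> fg; rewrite /kform big_map; apply: eq_bigr => x _.
by rewrite big_map; apply: eq_bigr.
Qed.

Lemma eq_map_all (A B : Type) (p : pred A) (f g : A -> B) (l : seq A) :
  all p l -> (forall a, p a -> f a = g a) -> map f l = map g l.
Proof.
by move=> + fg; elim: l => //= a l IH /andP[/fg -> /IH ->].
Qed.

Lemma dsum_cone (a : cone) : dsum S (sval a). Proof. exact: svalP. Qed.

Lemma dsum_restr_excess F (a b : cone) :
  dsum S (restr F (excess (sval a) (sval b))).
Proof. exact/dsum_restr/dsum_excess/svalP/svalP. Qed.
Hint Resolve dsum_cone dsum_restr_excess : core.

Lemma kernel_herm F x y : kernel F x y = (kernel F y x)^*.
Proof. exact: innerC. Qed.

Lemma kernel_semi F : (forall v, 0 <= complex.Re (kform (kernel F) v v)) ->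
  semi_inner cat scalev (kform (kernel F)).
Proof.
move=> pos; split => //; first exact: inhabits [::].
- exact: formv_catl.
- move=> c v w; rewrite /kform big_map mulr_sumr; apply: eq_bigr => x _.
  by rewrite mulr_sumr; apply: eq_bigr => y _; rewrite /kernel linearZ innerZl.
- exact/form_herm/kernel_herm.
Qed.

(** If [x] is later than [y] in the new coordinate [i], then this coordinate
    enters the kernel only through the operator [T_(x_i - y_i)] applied to the
    vector of [x]. *)
Lemma kernel_cons i F x y : i \notin F -> sval y.1 i <= sval x.1 i ->
  kernel (i :: F) x y =
  kernel F (x.1, T (single i (sval x.1 i - sval y.1 i)) x.2) y.
Proof.
move=> iF yx; rewrite /kernel !restr_cons//= (excess_ge yx) (excess_le yx).
rewrite single0 add0r addrC TD//; apply: dsum_single.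
by apply: S_sub => //; exact: (dsum_cone _).1.
Qed.

(** For [i] outside [F], the operators [T_r] with [r] in [S i] are contractive
    for the form of [F], since [T_r^* T_r] is symmetric for this form. *)
Lemma form_contraction i F (r : R) v : i \notin F -> S i r ->
  semi_inner cat scalev (kform (kernel F)) ->
  complex.Re (kform (kernel F) (mapv (T (single i r)) v)
                              (mapv (T (single i r)) v)) <=
  complex.Re (kform (kernel F) v v).
Proof.
move=> iF Sr hF; set Tr := T (single i r); have dr := dsum_single Sr.
pose N h := adj Tr (Tr h).
have N_com (a b : cone) h : N (T (restr F (excess (sval a) (sval b))) h) =
    T (restr F (excess (sval a) (sval b))) (N h).
  rewrite /N /Tr TC// nica_disjoint// => j.
  rewrite /single /restr.
  by case: eqP => [->|_]; [right; rewrite (negPf iF)|left].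
have N_sym h g : '[N h, g] = '[h, N g] by rewrite /N adjEr adjE.
have N_adj x y : kernel F (x.1, N x.2) y = kernel F x (y.1, N y.2).
  by rewrite /kernel /= -!N_com N_sym.
have -> : kform (kernel F) (mapv Tr v) (mapv Tr v) =
    kform (kernel F) (mapv N v) v.
  rewrite -[v in RHS]map_id /mapv /kform !big_map; apply: eq_bigr => x _.
  rewrite !big_map; apply: eq_bigr => y _; rewrite /kernel /=.
  by rewrite -N_com /N adjEr /Tr !(TC _ dr).
pose M := \sum_(x <- v) \sum_(y <- v) nm x.2 * nm y.2.
apply: (symmetric_power_bounded hF (M := M)) => [u w|n].
  exact: form_adj.
have iterN : iter n (mapv N) v = mapv (iter n N) v.
  elim: n => [|n IH]; first
    by rewrite /mapv /= -[LHS]map_id; apply: eq_map => -[].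
  by rewrite /= IH /mapv -map_comp.
have N_nm h : nm (iter n N h) <= nm h.
  elim: n {iterN} => //= n IH; apply: le_trans IH.
  apply: le_trans (contraction_nm _ (adj_contraction (T_contr dr))) _.
  exact: T_nm.
rewrite iterN /kform big_map raddf_sum; apply: ler_sum => x _.
rewrite raddf_sum; apply: ler_sum => y _; apply: le_trans (Re_le_nm _) _.
apply: le_trans (inner_le _ _) _; apply: ler_pM; rewrite ?nm_ge0//.
  by apply: le_trans (N_nm _); exact: T_nm.
exact: T_nm.
Qed.

(** For [tau] before all the times [x_i] let
    [y_tau = sum_x T_(x_i - tau) x]; it represents the compression of
    [V_tau^* v] to the space of the form of [F]. By induction from the
    latest vector, let [x0] be the earliest vector of [x0 :: v] and [t0] its
    time. As [y_t0] of [x0 :: v] is [x0] added to [y' = y_t0] of [v], both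
    [<x0 + v, x0 + v>_(i :: F)] and [<x0 + y', x0 + y'>_F] expand with the
    same diagonal and cross terms, and the remaining terms are compared by
    the induction hypothesis. Lowering the time from [t0] to [tau] applies
    the contraction [T_(t0 - tau)]. *)
Lemma chain_bound i F v (tau : R) : i \notin F ->
  semi_inner cat scalev (kform (kernel F)) ->
  sorted (fun x y => sval x.1 i <= sval y.1 i) v ->
  S i tau -> all (fun x => tau <= sval x.1 i) v ->
  let y := [seq (x.1, T (single i (sval x.1 i - tau)) x.2) | x <- v] in
  complex.Re (kform (kernel F) y y) <= complex.Re (kform (kernel (i :: F)) v v).
Proof.
move=> iF hF; pose up a w : seq (cone * H) :=
  [seq (x.1, T (single i (sval x.1 i - a)) x.2) | x <- w].
rewrite -/(up tau v); elim: v tau => [|x0 v IH] tau.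
  by rewrite /up /kform !big_nil.
rewrite [sorted _ _]/= path_sortedE; last by move=> ? ? ?; exact: le_trans.
move=> /andP[x0_min v_sorted] Stau; rewrite [all _ _]/= => /andP[tau_x0 tau_v].
have Sx (x : cone * H) : S i (sval x.1 i) by exact: (dsum_cone x.1).1.
set t0 := sval x0.1 i in x0_min tau_x0; have St0 : S i t0 := Sx x0.
have -> : up tau (x0 :: v) = mapv (T (single i (t0 - tau))) (up t0 (x0 :: v)).
  rewrite /mapv /up -map_comp.
  apply: (eq_map_all (p := fun x => t0 <= sval x.1 i)) => [|x /= t0x].
    by rewrite /= -/t0 lexx; exact: x0_min.
  have dx := dsum_single (S_sub (Sx x) St0 t0x).
  rewrite -(TD _ (dsum_single (S_sub St0 Stau tau_x0)) dx).
  by rewrite -singleD; congr (_, T (single i _) _); ring.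
apply: le_trans (form_contraction _ iF _ hF) _; first exact: S_sub.
have -> : up t0 (x0 :: v) = x0 :: up t0 v.
  by rewrite /up /= subrr single0 T0 -surjective_pairing.
have {}IH := IH t0 v_sorted (Sx x0) x0_min.
have form_cons k w : kform k (x0 :: w) (x0 :: w) =
    k x0 x0 + kform k [:: x0] w + kform k w [:: x0] + kform k w w.
  rewrite /kform big_seq1 !big_cons -!addrA; congr (_ + (_ + _)).
  by rewrite -big_split; apply: eq_bigr => x _; rewrite big_cons big_seq1.
rewrite !form_cons.
have -> : kernel (i :: F) x0 x0 = kernel F x0 x0.
  by rewrite kernel_cons// subrr single0 T0 -surjective_pairing.
have cross :
    kform (kernel (i :: F)) v [:: x0] = kform (kernel F) (up t0 v) [:: x0].
  rewrite /kform big_map; under [LHS]eq_bigr do rewrite big_seq1.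
  under [RHS]eq_bigr do rewrite big_seq1.
  elim: v x0_min {IH tau_v v_sorted} => [|x v IHv] /=.
    by rewrite !big_nil.
  by move=> /andP[x0x /IHv h]; rewrite !big_cons h kernel_cons.
rewrite [kform _ [:: x0] v](form_herm (kernel_herm _)).
rewrite [kform _ [:: x0] (up _ _)](form_herm (kernel_herm _)).
by rewrite cross ReD [leRHS]ReD lerD2l.
Qed.

Lemma kernel_pos F v : 0 <= complex.Re (kform (kernel F) v v).
Proof.
elim: F v => [|i F IH] v.
  have kE x y : kernel [::] x y = '[x.2, y.2].
    have r0 s : restr [::] s = 0 by apply/funext.
    by rewrite /kernel !r0 !T0.
  have -> : kform (kernel [::]) v v = '[\sum_(x <- v) x.2, \sum_(y <- v) y.2].
    rewrite linear_sumlz; apply: eq_bigr => x _; rewrite linear_sumr.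
    by apply: eq_bigr => y _.
  by rewrite -nm_sqE sqr_ge0.
have [iF|iF] := boolP (i \in F).
  have rE s : restr (i :: F) s = restr F s.
    by apply/funext => j; rewrite /restr inE; case: eqP => //= ->; rewrite iF.
  suff -> : kform (kernel (i :: F)) v v = kform (kernel F) v v by [].
  by apply: eq_bigr => x _; apply: eq_bigr => y _; rewrite /kernel !rE.
pose le_i := fun x y : {classic cone * H} => sval x.1 i <= sval y.1 i.
pose v' := sort le_i v.
have -> : kform (kernel (i :: F)) v v = kform (kernel (i :: F)) v' v'.
  have pv : perm_eq v' (v : seq {classic cone * H}) by rewrite perm_sort.
  rewrite /kform -(perm_big _ pv) /=; apply: eq_bigr => x _.
  by rewrite -(perm_big _ pv).
apply: le_trans (form_ge0 (kernel_semi IH) _) _.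
apply: (chain_bound (tau := 0) iF (kernel_semi IH)) => //.
  by apply: sort_sorted => x y; exact: le_total.
elim: v' => //= x w ->; rewrite andbT.
exact: S_nneg ((dsum_cone x.1).1 i).
Qed.

(** The kernel [<T_((t - s)^+)^* T_((s - t)^+) h, g>] of the dilation, written
    without adjoints, so that it is visibly hermitian. *)
Definition dilation_kernel x y : R[i] :=
  '[T (excess (sval x.1) (sval y.1)) x.2, T (excess (sval y.1) (sval x.1)) y.2].

Lemma eq_big_all (C : Type) (p : pred C) (f g : C -> R[i]) (l : seq C) :
  all p l -> (forall a, p a -> f a = g a) ->
  \sum_(a <- l) f a = \sum_(a <- l) g a.
Proof.
move=> pl fg; rewrite -(big_map f xpredT id) -(big_map g xpredT id).
by rewrite (eq_map_all pl fg).
Qed.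

Lemma common_support v :
  exists F, all (fun x => `[< forall i, i \notin F -> sval x.1 i = 0 >]) v.
Proof.
elim: v => [|x v [F hF]]; first by exists [::].
have [G hG] := dsum_restr_id (dsum_cone x.1); exists (G ++ F) => /=.
apply/andP; split.
  apply/asboolP => i; rewrite mem_cat negb_or => /andP[/negPf iG _].
  by rewrite -hG /restr iG.
apply: sub_all hF => y /asboolP hy; apply/asboolP => i.
by rewrite mem_cat negb_or => /andP[_]; exact: hy.
Qed.

(** Finitely many vectors involve finitely many coordinates, and on these the
    kernel agrees with some [kernel F]. *)
Lemma dilation_semi : semi_inner cat scalev (kform dilation_kernel).
Proof.
split; first exact: inhabits [::].
- exact: formv_catl.
- move=> c v w; rewrite /kform big_map mulr_sumr; apply: eq_bigr => x _.
  rewrite mulr_sumr; apply: eq_bigr => y _.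
  by rewrite /dilation_kernel linearZ innerZl.
- by apply: form_herm => x y; exact: innerC.
move=> v; have [F hF] := common_support v.
suff -> : kform dilation_kernel v v = kform (kernel F) v v by exact: kernel_pos.
apply: (eq_big_all hF) => x /asboolP hx.
apply: (eq_big_all hF) => y /asboolP hy.
have restrE (a b : cone) : (forall i, i \notin F -> sval a i = 0) ->
    restr F (excess (sval a) (sval b)) = excess (sval a) (sval b).
  move=> a0; apply/funext => i; rewrite /restr; case: ifPn => // /a0 ai.
  by rewrite excess_le// ai; exact: dsum_nneg (dsum_cone b).
by rewrite /kernel !restrE.
Qed.

Definition cone0 : cone := exist _ 0 dsum0.
Definition cone_add (a b : cone) : cone :=
  exist _ _ (dsumD (dsum_cone a) (dsum_cone b)).
Definition cone_excess (a b : cone) : cone :=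
  exist _ _ (dsum_excess (dsum_cone a) (dsum_cone b)).

Lemma cone_inj (a b : cone) : sval a = sval b -> a = b.
Proof. by case: a b => [a da] [b db] /= ab; exact: eq_exist. Qed.

(** On the dilation space [shift u] is [V_u] and [coshift u] is its adjoint. *)
Definition shift (u : cone) x := (cone_add x.1 u, x.2).
Definition coshift (u : cone) x :=
  (cone_excess x.1 u, adj (T (excess (sval u) (sval x.1))) x.2).

Lemma excessD2r s t u : excess (s + u) (t + u) = excess s t.
Proof.
apply/funext => i; rewrite /excess -[(s + u) i]/(s i + u i).
by rewrite -[(t + u) i]/(t i + u i) -addr_minl opprD addrACA subrr addr0.
Qed.

Lemma excess_addl s t u : dsum S s -> dsum S u ->
  excess (s + u) t = excess s (excess t u) + excess u t.
Proof.
move=> ds du; apply/funext => i.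
rewrite -[RHS]/(excess s (excess t u) i + excess u t i) /excess.
rewrite -[(s + u) i]/(s i + u i).
have := dsum_nneg i ds; have := dsum_nneg i du.
by case: (leP (t i) (u i)) => ?; repeat case: leP => ?; lra.
Qed.

Lemma excess_addr s t u : dsum S s -> dsum S u ->
  excess t (s + u) = excess (excess t u) s.
Proof.
move=> ds du; apply/funext => i; rewrite /excess -[(s + u) i]/(s i + u i).
have := dsum_nneg i ds; have := dsum_nneg i du.
by case: (leP (t i) (u i)) => ?; repeat case: leP => ?; lra.
Qed.

Lemma shift_isometric (u : cone) x y :
  dilation_kernel (shift u x) (shift u y) = dilation_kernel x y.
Proof. by rewrite /dilation_kernel /= !excessD2r. Qed.

(** Let [p = (t - u)^+] and [q = (u - t)^+], where [t] is the index of [y]. As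
    these have disjoint supports, [T_q^*] can be moved across
    [T_((p - s)^+)], where [s] is the index of [x]. *)
Lemma shift_adj (u : cone) x y :
  dilation_kernel (shift u x) y = dilation_kernel x (coshift u y).
Proof.
have du := dsum_cone u; have dx := dsum_cone x.1; have dy := dsum_cone y.1.
rewrite /dilation_kernel /= excess_addl// excess_addr//.
set p := excess (sval y.1) (sval u); set q := excess (sval u) (sval y.1).
have dp : dsum S p by exact: dsum_excess.
have dq : dsum S q by exact: dsum_excess.
have dxp : dsum S (excess (sval x.1) p) by exact: dsum_excess.
have dpx : dsum S (excess p (sval x.1)) by exact: dsum_excess.
rewrite addrC TD// adjE nica_disjoint// => i.
have [le|/ltW le] := leP (sval u i) (sval y.1 i).
  by left; exact: excess_le.
by right; apply: excess_le; rewrite /p (excess_le le); exact: dsum_nneg dx.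
Qed.

Lemma shift_coshift (u t : cone) x :
  (forall i, sval u i = 0 \/ sval t i = 0) ->
  shift u (coshift t x) = coshift t (shift u x).
Proof.
move=> ut; have du := dsum_cone u.
have s0 i := dsum_nneg i (dsum_cone x.1); have u0 i := dsum_nneg i du.
congr (_, adj (T _) _).
  apply: cone_inj; apply/funext => i /=.
  rewrite -[LHS]/(excess (sval x.1) (sval t) i + sval u i) /excess.
  rewrite -[(sval x.1 + _) i]/(sval x.1 i + sval u i).
  have [->|->] := ut i; first by rewrite !addr0.
  by rewrite !min_r ?addr_ge0// !subr0.
apply/funext => i; rewrite /excess /=.
rewrite -[(sval x.1 + _) i]/(sval x.1 i + sval u i).
have [->|->] := ut i; first by rewrite addr0.
by rewrite !min_l ?addr_ge0.
Qed.

(** * The dilation *)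

Section Dynamics.
Context {A : cstarType R} {alpha : (I -> R) -> A -> A} {sigma : A -> 'B(H)}.
Hypothesis alpha_dyn : dynamical_system S alpha.
Hypothesis sigma_rep : representation sigma.
Hypothesis sigma_cc : completely_contractive sigma.
Hypothesis sigma_cov : covariant S alpha sigma T.
Implicit Types a b : A.

Lemma sigma_alpha_rep s : dsum S s ->
  representation (fun a => sigma (alpha s a)).
Proof.
case: alpha_dyn => dyn _ _ /dyn[a_lin a_mul _ _].
by split=> [c a b x|a b x]; rewrite ?a_lin ?a_mul ?sigma_rep.1 ?sigma_rep.2.
Qed.

Lemma sigma_alpha_adj s a h g : dsum S s ->
  '[sigma (alpha s a) h, g] = '[h, sigma (alpha s (star a)) g].
Proof.
move=> ds; apply: (contractive_rep_hermitian (sigma_alpha_rep ds)) => {}a x.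
case: alpha_dyn => /(_ s ds)[_ _ _ a_ci] _ _.
exact: (completely_contractive_nm (f := alpha s) sigma_cc a_ci).
Qed.

(** The twist by [alpha_s] is forced by covariance:
    [pi(a) V_s h = V_s pi(alpha_s a) h]. *)
Definition act a x := (x.1, sigma (alpha (sval x.1) a) x.2).

(** Covariance moves [sigma] through the kernel: both sides are equal to
    [<sigma (alpha_m a) T_(s - m) h, T_(t - m) g>], where [m] is the minimum of
    [s] and [t]. *)
Lemma act_adj a x y :
  dilation_kernel (act a x) y = dilation_kernel x (act (star a) y).
Proof.
have ds := dsum_cone x.1; have dt := dsum_cone y.1.
set s := sval x.1 in ds; set t := sval y.1 in dt.
pose m i := Num.min (s i) (t i).
have dm : dsum S m.
  split=> [i|]; first by rewrite /m; case: leP => _; [exact: ds.1|exact: dt.1].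
  apply: sub_finite_set ds.2 => i /=; apply: contra_neq => si.
  by rewrite /m si min_l// (dsum_nneg i dt).
have sE : s = m + excess s t.
  by apply/funext => i; rewrite -[RHS]/(m i + (s i - m i)); ring.
have tE : t = m + excess t s.
  apply/funext => i; rewrite -[RHS]/(m i + (t i - Num.min (t i) (s i))).
  by rewrite minC -/(m i); ring.
have dst := dsum_excess ds dt; have dts := dsum_excess dt ds.
case: alpha_dyn => _ _ alphaD.
have move_in r b h : dsum S r ->
    T r (sigma (alpha (m + r) b) h) = sigma (alpha m b) (T r h).
  by move=> dr; rewrite addrC alphaD//; exact: esym (sigma_cov _ dr h).
rewrite /dilation_kernel /= -/s -/t.
have := move_in _ (star a) y.2 dts; rewrite -tE => ->.
have := move_in _ a x.2 dst; rewrite -sE => ->.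
exact: sigma_alpha_adj.
Qed.

Lemma act_nm a v : seminorm (kform dilation_kernel) (map (act (star a)) v) <=
  nm a * seminorm (kform dilation_kernel) v.
Proof.
rewrite -(nm_star a); move: (star a) => {}a.
apply: (star_rep_contractive (rho := fun a => map (act a)) dilation_semi).
- move=> b c u w; rewrite /kform !big_map -big_split; apply: eq_bigr => x _.
  rewrite -big_split; apply: eq_bigr => y _; rewrite /dilation_kernel /=.
  by rewrite (repD (sigma_alpha_rep (dsum_cone x.1))) linearD innerDl.
- move=> c b u w; rewrite /kform !big_map mulr_sumr; apply: eq_bigr => x _.
  rewrite mulr_sumr; apply: eq_bigr => y _; rewrite /dilation_kernel /=.
  by rewrite (repZ (sigma_alpha_rep (dsum_cone x.1))) linearZ innerZl.
- move=> b c u w; rewrite -map_comp /kform !big_map; apply: eq_bigr => x _.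
  apply: eq_bigr => y _; rewrite /dilation_kernel /=.
  by rewrite (repM (sigma_alpha_rep (dsum_cone x.1))).
- move=> b u w; apply: form_adj => x y; exact: act_adj.
Qed.

Local Notation K := (completion dilation_semi).
Local Notation B := (kform dilation_kernel).

Lemma B_shift (u : cone) v w :
  B (map (shift u) v) w = B v (map (coshift u) w).
Proof. exact/form_adj/shift_adj. Qed.

Lemma B_act a v w : B (map (act a) v) w = B v (map (act (star a)) w).
Proof. exact/form_adj/act_adj. Qed.

Lemma B_coshift (u : cone) v w :
  B (map (coshift u) v) w = B v (map (shift u) w).
Proof. by rewrite (formC dilation_semi) -B_shift -(formC dilation_semi). Qed.

Lemma seminorm_shift (u : cone) v :
  seminorm B (map (shift u) v) = seminorm B v.
Proof. by rewrite /seminorm (form_map _ _ (shift_isometric u)). Qed.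

Lemma seminorm_coshift (u : cone) v :
  seminorm B (map (coshift u) v) <= 1 * seminorm B v.
Proof.
rewrite mul1r; apply: (seminorm_le dilation_semi); first exact: seminorm_ge0.
move=> w; rewrite B_coshift -(seminorm_shift u w).
exact: cauchy_schwarz dilation_semi _ _.
Qed.

Lemma dilation_pi_exists a :
  exists P : 'B(K), forall g v, P g v = g (map (act (star a)) v).
Proof.
exact: (@lift_exists _ _ _ _ _ dilation_semi _ _ _ (B_act a) (act_nm a)).
Qed.

Lemma dilation_V_exists s : exists W : 'B(K),
  forall (ds : dsum S s) g v, W g v = g (map (coshift (exist _ s ds)) v).
Proof.
have [ds|nds] := pselect (dsum S s); last by exists (bop0 _ _) => ds.
have [W hW] := @lift_exists _ _ _ _ _ dilation_semi _ _ 1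
  (B_shift (exist _ s ds)) (seminorm_coshift _).
exists W => ds'; by rewrite (Prop_irrelevance ds' ds).
Qed.

Definition dilation_pi a : 'B(K) := sval (cid (dilation_pi_exists a)).
Definition dilation_V s : 'B(K) := sval (cid (dilation_V_exists s)).
Local Notation pi := dilation_pi.
Local Notation V := dilation_V.
Implicit Types g : K.

Lemma piE a g v : pi a g v = g (map (act (star a)) v).
Proof. by rewrite /pi; case: cid. Qed.

Lemma VE (s : cone) g v : V (sval s) g v = g (map (coshift s) v).
Proof.
rewrite /V; case: cid => W /= hW; rewrite (hW (dsum_cone s)).
by rewrite (_ : exist _ _ _ = s)//; exact: cone_inj.
Qed.

Lemma pi_embed a v : pi a (embed _ v) = embed dilation_semi (map (act a) v).
Proof. by apply: completion_ext => w; rewrite piE /= -B_act. Qed.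

Lemma V_embed (s : cone) v :
  V (sval s) (embed _ v) = embed dilation_semi (map (shift s) v).
Proof. by apply: completion_ext => w; rewrite VE /= -B_shift. Qed.

Lemma adj_pi a g : adj (pi a) g = pi (star a) g.
Proof.
apply: completion_ext => w.
by rewrite -inner_embed adjEr pi_embed inner_embed piE starK.
Qed.

Lemma adj_V (s : cone) g v : adj (V (sval s)) g v = g (map (shift s) v).
Proof. by rewrite -inner_embed adjEr V_embed inner_embed. Qed.

Lemma cone_of s : dsum S s -> exists a : cone, sval a = s.
Proof. by move=> ds; exists (exist _ s ds). Qed.

Lemma V_rep : semigroup_representation S V.
Proof.
split=> [g|s t /cone_of[{}s <-] /cone_of[{}t <-] g];
  apply: completion_ext => w.
  have [z z0] := cone_of dsum0; rewrite -z0 VE /=; apply: completion_eqr => v.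
  rewrite -B_shift; congr (B _ w); rewrite -[RHS]map_id.
  apply: eq_map => -[a h].
  by congr pair; apply: cone_inj; rewrite /= z0 addr0.
have [st ste] := cone_of (dsumD (dsum_cone s) (dsum_cone t)).
rewrite -ste /= !VE; apply: completion_eqr => v.
rewrite -!B_shift -map_comp; congr (B _ w); apply: eq_map => x.
by congr pair; apply: cone_inj; rewrite /= ste [sval s + _]addrC addrA.
Qed.

(** The shift has the left inverse [coshift], and both are contractive. *)
Lemma V_isometric s : dsum S s -> isometric (V s).
Proof.
move=> /cone_of[{}s <-] g; rewrite !nmE; congr (_%:C)%C; apply/eqP.
rewrite eq_le; apply/andP; split.
  apply: completion_nm_le => [|w]; first exact: nm_ge0.
  rewrite VE; apply: le_trans (completion_le _ _) _.
  rewrite ler_wpM2l ?nm_ge0//; have := seminorm_coshift s w; rewrite mul1r//.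
apply: completion_nm_le => [|w]; first exact: nm_ge0.
have -> : g w = V (sval s) g (map (shift s) w).
  rewrite VE; apply: completion_eqr => v.
  by rewrite -B_shift (form_map _ _ (shift_isometric s)).
by rewrite -(seminorm_shift s w); exact: completion_le.
Qed.

Lemma V_nica : nica_covariant S V.
Proof.
move=> i j s t ij [/cone_of[{}s <-] s_i] [/cone_of[{}t <-] t_j] g.
apply: completion_ext => w /=; rewrite adj_V !VE adj_V -!map_comp.
congr (g _); apply: eq_map => x /=; rewrite shift_coshift// => k.
have [->|/eqP/s_i] := eqVneq k i; [right; exact: t_j|by left].
Qed.

Lemma pi_rep : representation pi.
Proof.
split=> [c a b g|a b g]; apply: completion_ext => w.
  rewrite completionD completionZ !piE.
  have -> : c = c^*^* by rewrite conjCK.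
  rewrite -completionZr -completionDr; apply: completion_eqr => v.
  rewrite (formDr dilation_semi) (formZr dilation_semi) -!B_act.
  rewrite conjCK /kform !big_map mulr_sumr -big_split; apply: eq_bigr => x _.
  rewrite mulr_sumr -big_split; apply: eq_bigr => y _.
  rewrite /dilation_kernel /=.
  by rewrite (sigma_alpha_rep (dsum_cone x.1)).1 linearP innerDl innerZl.
rewrite /= !piE -map_comp; congr (g _); apply: eq_map => x /=.
by rewrite /act /= starM (repM (sigma_alpha_rep (dsum_cone x.1))).
Qed.

Lemma pi_star_rep : star_representation pi.
Proof. by split; [exact: pi_rep|move=> a g; rewrite adj_pi]. Qed.

Lemma V_cov : covariant S alpha pi V.
Proof.
move=> s a /cone_of[{}s <-] g; apply: completion_ext => w /=.
rewrite piE !VE piE; apply: completion_eqr => v.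
rewrite -B_act -!B_shift -B_act -!map_comp; congr (B _ w).
apply: eq_map => x /=.
rewrite /act /shift /=; congr (_, sigma _ _).
case: alpha_dyn => _ _ ->//; exact: dsum_cone.
Qed.

Lemma dilation_rep : isometric_nica_representation S alpha pi V.
Proof.
split; last exact: V_isometric; split.
- exact: pi_rep.
- exact/star_rep_completely_contractive/pi_star_rep.
- exact: V_rep.
- exact: V_nica.
- exact: V_cov.
Qed.

Lemma iota_exists : exists j : bop H K,
  forall h, j h = embed dilation_semi [:: (cone0, h)].
Proof.
apply: bop_exists => [c h g|].
  apply: completion_ext => w.
  rewrite completionD completionZ /= /kform !big_seq1.
  rewrite mulr_sumr -big_split; apply: eq_bigr => x _.
  by rewrite /dilation_kernel /= linearP innerDl innerZl.
exists 1 => h; rewrite mul1r nm_embed /seminorm /kform !big_seq1.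
have e0 : excess 0 0 = 0 :> (I -> R) by apply/funext => i; exact: excess_le.
by rewrite /dilation_kernel /= e0 T0 inner_nm /= sqrtr_sqr ger0_norm ?nm_ge0.
Qed.


Lemma excess0r (s : cone) : excess (sval s) 0 = sval s.
Proof.
apply/funext => i; rewrite excess_ge ?subr0//.
exact: dsum_nneg (dsum_cone s).
Qed.

Lemma excess0l (s : cone) : excess 0 (sval s) = 0.
Proof. by apply/funext => i; rewrite excess_le// dsum_nneg//; exact: svalP. Qed.

(** Supports are handled as sequences of indices, hence the choice type. *)
Theorem nica_dilation_choice :
  exists (K : hilbertType R) (iota : bop H K)
         (pi : A -> 'B(K)) (V : (I -> R) -> 'B(K)),
    isometric iota /\
    isometric_nica_representation S alpha pi V /\
    (forall a h, pi a (iota h) = iota (sigma a h)) /\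
    (forall s h, dsum S s -> oproj (range iota) (V s (iota h)) = iota (T s h)) /\
    closure (lin_span (\bigcup_(s in dsum S) range (V s \o iota))) = setT.
Proof.
have [j jE] := iota_exists.
have V_j (s : cone) h : V (sval s) (j h) = embed dilation_semi [:: (s, h)].
  rewrite jE V_embed /= /shift /=; congr (embed _ [:: (_, _)]).
  by apply: cone_inj; rewrite /= add0r.
exists K, j, pi, V; split; last split; [|exact: dilation_rep|split; [|split]].
- move=> h; rewrite !nmE jE nm_embed /seminorm /kform !big_seq1.
  rewrite /dilation_kernel.
  by rewrite /= (excess0l cone0) T0 inner_nm /= sqrtr_sqr ger0_norm ?nm_ge0.
- move=> a h; rewrite !jE pi_embed /act /=; congr (embed _ [:: (_, sigma _ _)]).
  by case: alpha_dyn => _ ->.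
- move=> s h /cone_of[{}s <-]; apply: oproj_range => k.
  rewrite innerBl V_j !jE !inner_embed /= /kform !big_seq1 /dilation_kernel /=.
  by rewrite excess0r excess0l (excess0l cone0) !T0 subrr.
apply/seteqP; split => // g _ U /nbhs_ballP[e /= e0 eU].
move: e0 eU; rewrite ltcE => /andP[/eqP/= e_real e0].
have -> : e = (complex.Re e)%:C%C by apply: complex_ext.
move=> eU; have e2 : 0 < complex.Re e / 2 by rewrite divr_gt0.
have [v gv] := completion_approx g e2; exists (embed dilation_semi v); split.
  exists (size v), (fun=> 1).
  exists (fun k => embed dilation_semi [:: tnth (in_tuple v) k]); split.
    move=> k; case: (tnth _ k) => s h; exists (sval s); first exact: dsum_cone.
    by exists h => //=; rewrite V_j.
  under eq_bigr do rewrite scale1r.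
  rewrite -(big_tnth _ _ v xpredT (fun x => embed dilation_semi [:: x])).
  elim: v {gv} => [|x v IH]; apply: completion_ext => w.
    by rewrite big_nil /= /kform big_nil.
  rewrite big_cons -IH completionD /= -cat1s; exact: formv_catl.
apply: eU; rewrite -ball_normE /= nmE ltcR.
apply: le_lt_trans (approx_nm (ltW e2) gv) _; lra.
Qed.

End Dynamics.
End Nica.
End DirectSumCone.

Theorem theorem3p5 (R : realType) (I : Type) (S : I -> set R)
    (S_countable : forall i, countable (S i))
    (S_nneg : forall i x, S i x -> 0 <= x)
    (S_zero : forall i, S i 0)
    (S_add : forall i x y, S i x -> S i y -> S i (x + y))
    (S_cone : forall i,
      S i = [set x - y | x in S i & y in S i] `&` [set x | 0 <= x])
    (A : cstarType R) (alpha : (I -> R) -> A -> A)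
    (alpha_dyn : dynamical_system S alpha)
    (H : hilbertType R) (sigma : A -> 'B(H)) (T : (I -> R) -> 'B(H))
    (sigmaT_rep : contractive_nica_representation S alpha sigma T) :
  exists (K : hilbertType R) (iota : bop H K)
         (pi : A -> 'B(K)) (V : (I -> R) -> 'B(K)),
    isometric iota /\
    isometric_nica_representation S alpha pi V /\
    (forall a h, pi a (iota h) = iota (sigma a h)) /\
    (forall s h, dsum S s -> oproj (range iota) (V s (iota h)) = iota (T s h)) /\
    closure (lin_span (\bigcup_(s in dsum S) range (V s \o iota))) = setT.
Proof.
have [[sigma_rep sigma_cc T_rep T_nica sigma_cov] T_contr] := sigmaT_rep.
(* Classically every index set is a choice type. *)
exact: (@nica_dilation_choice R {classic I} S S_nneg S_zero S_add S_cone H T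
  T_rep T_nica T_contr A alpha sigma alpha_dyn sigma_rep sigma_cc sigma_cov).
Qed.
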